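(* Let $d\ge 1$ be a fixed integer and let $Y_t=\mu_t+\varepsilon_t$, $t=1,\dots,n$, where $\{\varepsilon_t\}$ is a mean zero stationary process, $\nabla^d\mu_t=\gamma_t$ with $\{\gamma_t\}$ i.i.d. with mean zero and variance $\tau^2/n^{2d-1}$ for a fixed constant $\tau>0$, and the error process $\{\varepsilon_t\}$ is independent of $\{\gamma_t\}$ (and of the trend $\mu$). Let $\rho_\varepsilon(j)$ be the lag-$j$ autocovariance of $\{\varepsilon_t\}$ and assume $\sum_{1\le j<\infty} j|\rho_\varepsilon(j)|<\infty$. Let $g_\varepsilon(u)=\sum_{-\infty<j<\infty}\rho_\varepsilon(j)e^{iju}$ and assume $g_\varepsilon(0)>0$. Let $\hat\mu=\hat\mu(\nu)$ be the penalized least squares estimate of $\mu=(\mu_1,\dots,\mu_n)'$ with difference order $d$ and penalty parameter $\nu=\nu_n>0$, and let $\overline\mu=E(\hat\mu\mid\mu)$. If $\nu\to\infty$ and $\nu/n^{2d}\to 0$ as $n\to\infty$, then $$E\|\hat\mu-\overline\mu\|^2/n=c_1\,\nu^{-1/(2d)}\left[1+O(\nu^{-1/(2d)})+O(\nu^{1/(2d)}/n)\right],$$ where $c_1=g_\varepsilon(0)\,\mathrm{Beta}(1/(2d),\,2-1/(2d))/(2d\pi)$.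
   Context: $\nabla$ is the backward difference operator, $\nabla x_t=x_t-x_{t-1}$, and $\nabla^d$ its $d$-th iterate; the relation $\nabla^d\mu_t=\gamma_t$ is used for $t=d+1,\dots,n$. Equivalently, $\mu_t$ is the sum of a polynomial in $t$ of degree at most $d-1$ (with coefficients fixed or random) and $\sum_{1\le j\le t}(-1)^{t-j}\binom{-d}{t-j}\gamma_j$. The law of the error process $\{\varepsilon_t\}$ does not depend on $n$. $\|\cdot\|$ is the Euclidean norm on $\mathbb{R}^n$, prime denotes transpose, and $\mathrm{Beta}(a,b)=\int_0^1 x^{a-1}(1-x)^{b-1}\,dx$. The penalized least squares estimate $\hat\mu(\nu)$ is the minimizer over $\mu\in\mathbb{R}^n$ of $\sum_{1\le t\le n}(Y_t-\mu_t)^2+\nu\sum_{d+1\le t\le n}(\nabla^d\mu_t)^2$. Explicitly, let $S_{-d}$ be the $n\times n$ lower triangular matrix with $(t,j)$ entry $(-1)^{t-j}\binom{d}{t-j}$ for $t\ge j$ (and $0$ for $t<j$), and let $\overline S_{-d}$ be the $(n-d)\times n$ matrix obtained by deleting its first $d$ rows; then $\hat\mu(\nu)=(I+\nu\,\overline S_{-d}'\overline S_{-d})^{-1}Y$ with $Y=(Y_1,\dots,Y_n)'$, and $\overline\mu=E(\hat\mu\mid\mu)=(I+\nu\,\overline S_{-d}'\overline S_{-d})^{-1}\mu$. *)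

(* Defs.v *)
From HB Require Import structures.
From mathcomp Require Export all_boot all_order all_algebra.
From mathcomp Require Export all_classical all_reals all_analysis.
From mathcomp Require Export complex.

Export numFieldNormedType.Exports.
Set Implicit Arguments.
Unset Strict Implicit.
Unset Printing Implicit Defensive.

Import Order.TTheory GRing.Theory Num.Theory.
Local Open Scope classical_set_scope.
Local Open Scope ring_scope.

Section Vectors.
Context {R : realType}.

(* v_t for t = 1, ..., n, in the one-based numbering of time, and 0 at other
   times; the entry v_t is stored at row t - 1. *)
Definition entry n (v : 'cV[R]_n) (t : nat) : R :=
  \sum_(i < n | i.+1 == t) v i 0.

(* The Euclidean norm; MathComp-Analysis' `|v| on matrices is the max norm. *)
Definition enorm n (v : 'cV[R]_n) : R := Num.sqrt (\sum_(i < n) v i 0 ^+ 2).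

(* At time t >= 1; iter d nabla x t only reads x_{t-d}, ..., x_t when d <= t. *)
Definition nabla (x : nat -> R) (t : nat) : R := x t - x t.-1.

Definition pls_criterion d n (nu : R) (Y m : 'cV[R]_n) : R :=
  \sum_(1 <= t < n.+1) (entry Y t - entry m t) ^+ 2
  + nu * \sum_(d.+1 <= t < n.+1) iter d nabla (entry m) t ^+ 2.

Definition is_pls_estimate d n (nu : R) (Y mhat : 'cV[R]_n) : Prop :=
  forall m : 'cV[R]_n, pls_criterion d nu Y mhat <= pls_criterion d nu Y m.

Definition Beta (a b : R) : R :=
  \int[lebesgue_measure]_(x in `[0, 1]) (x `^ (a - 1) * (1 - x) `^ (b - 1)).

(* Limit of the partial sums over -N <= j <= N. *)
Definition sumZ (f : int -> R) : R :=
  limn (fun N => \sum_(i < N.*2.+1) f (i%:Z - N%:Z)).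

(* The complex series of the terms rho(j) e^{iju}, summed componentwise. *)
Definition spectral (rho : int -> R) (u : R) : R[i] :=
  Complex (sumZ (fun j => rho j * cos (j%:~R * u)))
          (sumZ (fun j => rho j * sin (j%:~R * u))).

End Vectors.

Section Processes.
Context {d : measure_display} {T : measurableType d} {R : realType}.
Implicit Types P : probability T R.

(* The sigma-algebra generated by the X_i, i in D. *)
Definition sigma_gen {I : Type} (D : set I) (X : I -> T -> R) : set (set T) :=
  <<s \bigcup_(i in D) preimage_set_system setT (X i) measurable >>.

Definition indep_sigma P (F G : set (set T)) : Prop :=
  forall A B, F A -> G B -> P (A `&` B) = (P A * P B)%E.

Definition iid {I : choiceType} P (D : set I) (X : I -> T -> R) : Prop :=
  (forall (s : seq I) (B : I -> set R), uniq s -> [set` s] `<=` D ->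
     (forall i, measurable (B i)) ->
     P (\bigcap_(i in [set` s]) X i @^-1` B i)
       = (\prod_(i <- s) P (X i @^-1` B i))%E) /\
  (forall i j (B : set R), D i -> D j -> measurable B ->
     P (X i @^-1` B) = P (X j @^-1` B)).

(* Stationarity in the second-order sense, as implied by strict stationarity
   for square integrable processes. *)
Definition stationary P (X : int -> T -> R) : Prop :=
  [/\ forall t, X t \in Lfun P 2%:E,
      forall s t, ('E_P[X s] = 'E_P[X t])%E &
      forall s t h, covariance P (X (s + h)) (X (t + h))
                    = covariance P (X s) (X t)].

Definition autocov P (X : int -> T -> R) (j : int) : R :=
  fine (covariance P (X 0) (X j)).

(* Z is a version of E(X | G), for a sub-sigma-algebra G. X need not be
   integrable, only sigma-integrable with respect to G; for integrable X this
   is the usual definition, and Z is almost surely unique in all cases. *)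
Definition is_condexp P (G : set (set T)) (X Z : T -> R) : Prop :=
  [/\ exists F : nat -> set T, [/\ forall k, G (F k),
        \bigcup_k F k = setT & forall k, P.-integrable (F k) (EFin \o X)],
      forall B : set R, measurable B -> G (Z @^-1` B) &
      forall A, G A -> P.-integrable A (EFin \o X) ->
        P.-integrable A (EFin \o Z) /\
        (\int[P]_(w in A) (Z w)%:E = \int[P]_(w in A) (X w)%:E)%E].

End Processes.

(* Equality of the finite-dimensional distributions. *)
Definition same_law {R : realType} {d d' : measure_display}
    {T : measurableType d} {T' : measurableType d'}
    (P : probability T R) (P' : probability T' R)
    (X : int -> T -> R) (X' : int -> T' -> R) : Prop :=
  forall (s : seq int) (B : int -> set R), (forall t, measurable (B t)) ->
    P (\bigcap_(t in [set` s]) X t @^-1` B t)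
    = P' (\bigcap_(t in [set` s]) X' t @^-1` B t).

(* Main.v *)
(* The penalized least squares estimate is [G Y] with [G = (I + nu D'D)^-1], [D]
   the (n - d) x n difference matrix, so that [muhat - mubar = G eps] almost
   surely and the risk is [tr (G^2 Gamma) / n], [Gamma] the Toeplitz matrix of
   autocovariances. Adding the [d] missing cyclic rows to [D] turns it into a
   circulant; each of these rank-one updates of [I + nu D'D] changes
   [tr (G^2 Gamma)] by a bounded amount (Sherman-Morrison and
   [0 <= G <= I]). The circulant is diagonalized by waves of frequency
   [2 pi k / n], with eigenvalues [1 + nu y_k^(2d)], [y_k = 2 sin (pi k / n)],
   and [tr (G^2 Gamma)] becomes the sum over [k] of [(1 + nu y_k^(2d))^-2] times
   the mean periodogram of [eps] at that frequency, which is
   [g_eps(0) + O(y_k + 1/n)]. What remains is a Riemann sum of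
   [(1 + x^(2d))^-2] with step [2 pi nu^(1/2d) / n], whose integral over
   the half line is [Beta(1/2d, 2 - 1/2d) / (2d)]. *)

Require Import Defs.
From mathcomp Require Import all_boot all_order all_algebra.
From mathcomp Require Import all_classical all_reals all_analysis complex.
From mathcomp Require Import measurable_realfun.
From mathcomp Require Import ring lra zify.
Import Order.TTheory GRing.Theory Num.Theory.
Import numFieldNormedType.Exports.
Local Open Scope classical_set_scope.
Local Open Scope ring_scope.
Set Implicit Arguments.
Unset Strict Implicit.
Unset Printing Implicit Defensive.

(** * Rank-one updates of a regularized Gram matrix *)

(** Put [v = nu^(1/(2d))]. The trace has a main term of order [n / v], so the two relative errors
    that the theorem allows, [1 / v] and [v / n], are absolute errors [n / v ^+ 2] and [1] in the
    trace, and each approximation is an inequality charged to one of these two accounts. Edge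
    effects cost [O(1)]: the missing cyclic rows, whose number does not grow with [n], the
    frequencies left without a mirror image, and the lags that a sample of size [n] cannot see.
    Errors proportional to the frequency cost [O(n / v ^+ 2)], the first moment of the kernel over
    the frequencies; they are the variation of the spectrum near 0 and the gap between
    [2 sin (theta / 2)] and [theta]. The weight [j] in the summability of the autocovariances is
    spent twice, on the variation of the spectrum and on the missing lags. On the probabilistic side
    the obstacle is that the trend may fail to be integrable. The conditional mean of the estimate
    is therefore identified on a localizing sequence of events, and only almost surely. *)

Section Dot.
Variable R : realType.

Definition dot n (x y : 'cV[R]_n) : R := \sum_(i < n) x i 0 * y i 0.

Lemma dotE n (x y : 'cV[R]_n) : x^T *m y = (dot x y)%:M.
Proof.
by rewrite [LHS]mx11_scalar; congr _%:M; rewrite mxE; apply: eq_bigr => i _; rewrite mxE.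
Qed.

Lemma dotC n (x y : 'cV[R]_n) : dot x y = dot y x.
Proof. by apply: eq_bigr => i _; rewrite mulrC. Qed.

Lemma dotDr n (x y z : 'cV[R]_n) : dot x (y + z) = dot x y + dot x z.
Proof. by rewrite -big_split; apply: eq_bigr => i _; rewrite mxE mulrDr. Qed.

Lemma dotZr n a (x y : 'cV[R]_n) : dot x (a *: y) = a * dot x y.
Proof. by rewrite mulr_sumr; apply: eq_bigr => i _; rewrite mxE mulrCA. Qed.

Lemma dot_ge0 n (x : 'cV[R]_n) : 0 <= dot x x.
Proof. by apply: sumr_ge0 => i _; rewrite -expr2 sqr_ge0. Qed.

Lemma dot_eq0 n (x : 'cV[R]_n) : dot x x <= 0 -> x = 0.
Proof.
move=> x0; apply/matrixP => i j; rewrite (ord1 j) mxE.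
have e : \sum_(i < n) x i 0 * x i 0 = 0 by apply/eqP; rewrite eq_le x0 dot_ge0.
have /psumr_eq0P h := e.
by apply/eqP; rewrite -sqrf_eq0 expr2 h // => k _; rewrite -expr2 sqr_ge0.
Qed.

Lemma outer_mul n p (x : 'cV[R]_p) (y z : 'cV[R]_n) : x *m y^T *m z = dot y z *: x.
Proof. by rewrite -mulmxA dotE mul_mx_scalar. Qed.

Lemma dot_mull n m (M : 'M[R]_(m, n)) x y : dot (M *m x) y = dot x (M^T *m y).
Proof.
have : (dot (M *m x) y)%:M = (dot x (M^T *m y))%:M :> 'M[R]_1.
  by rewrite -!dotE trmx_mul mulmxA.
by move/matrixP => /(_ 0 0); rewrite !mxE.
Qed.

Lemma tr_outer n (x y : 'cV[R]_n) M : \tr (x *m y^T *m M) = dot y (M *m x).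
Proof.
by rewrite -mulmxA mxtrace_mulC -mulmxA dotE /mxtrace big_ord1 mxE.
Qed.

Lemma cauchy_dot n (x y : 'cV[R]_n) : dot x y ^+ 2 <= dot x x * dot y y.
Proof.
have [->|y0] := eqVneq y 0.
  rewrite (_ : dot x 0 = 0) ?expr0n ?mulr_ge0 ?dot_ge0 //.
  by rewrite /dot big1 // => i _; rewrite mxE mulr0.
have yy : 0 < dot y y.
  by rewrite lt_neqAle dot_ge0 andbT eq_sym; apply: contra y0 => /eqP e; apply/eqP/dot_eq0;
    rewrite e.
have := dot_ge0 (dot y y *: x + (- dot x y) *: y).
rewrite dotDr !dotZr ![dot (_ + _) _]dotC !dotDr !dotZr (dotC y x).
set a := dot x x; set b := dot x y; set c := dot y y => h.
have : 0 <= c * (a * c - b ^+ 2) by apply: le_trans h _; rewrite le_eqVlt; apply/orP; left;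
  apply/eqP; ring.
by rewrite pmulr_rge0 // subr_ge0.
Qed.

(** Symmetric with [A >= I] in the Loewner order, hence [0 <= A^-1 <= I]. *)
Definition above_id n (A : 'M[R]_n) := A^T = A /\ forall x, dot x x <= dot x (A *m x).

Lemma above_id_unit n (A : 'M[R]_n) : above_id A -> A \in unitmx.
Proof.
move=> [As A1]; rewrite -row_free_unit -kermx_eq0; apply/eqP/row_matrixP => i.
rewrite row0; apply: trmx_inj; rewrite trmx0; apply: dot_eq0.
apply: (le_trans (A1 _)).
have -> : A *m (row i (kermx A))^T = 0.
  by rewrite -[X in X *m _]As -trmx_mul -row_mul mulmx_ker row0 trmx0.
rewrite /dot big1 // => j _.
by rewrite [X in _ * X]mxE mulr0.
Qed.

(** This is [A >= I] tested at [y = A^-1 x]: [y.y <= y.(A y) = y.x]. *)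
Lemma above_id_inv_contract n (A : 'M[R]_n) x : above_id A ->
  dot (invmx A *m x) (invmx A *m x) <= dot x (invmx A *m x).
Proof.
move=> hA; have uA := above_id_unit hA.
have := hA.2 (invmx A *m x); rewrite mulmxA mulmxV // mul1mx.
by rewrite (dotC x).
Qed.

Lemma above_id_inv_norm n (A : 'M[R]_n) x : above_id A ->
  dot (invmx A *m x) (invmx A *m x) <= dot x x.
Proof.
move=> hA; have := above_id_inv_contract x hA.
have := cauchy_dot x (invmx A *m x); have := dot_ge0 x.
have := dot_ge0 (invmx A *m x).
set a := dot (_ *m _) _; set b := dot _ (_ *m _); set c := dot _ _ => ha hc h2 h1.
have [->//|a0] := eqVneq a 0.
have a_gt0 : 0 < a by rewrite lt_neqAle eq_sym a0.
rewrite -(ler_pM2r a_gt0); apply: le_trans h2; nra.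
Qed.

(** An operator norm bound written with the mean of the squared norms instead of the product of the
    norms: a row-sum estimate yields it directly, and it serves as well when one argument is a
    contraction of the other. *)
Definition form_bounded n (B : R) (S : 'M[R]_n) :=
  forall x y, `|dot x (S *m y)| <= B * ((dot x x + dot y y) / 2).

Lemma invmx_unique n (A B : 'M[R]_n) : A *m B = 1%:M -> invmx A = B.
Proof.
move=> AB; have [uA _] := mulmx1_unit AB.
by rewrite -[RHS]mul1mx -(mulVmx uA) -mulmxA AB mulmx1.
Qed.

(** With [G = A^-1], [v = G w] and [s = w.v], the update subtracts [c v v^T] from [G], where
    [c = nu / (1 + nu s)]. The difference of the squares is then a sum of three outer products, each
    of weight at most [c (v.v) <= c s <= 1], so each contributes at most [B] to the trace, whatever
    [w] and [nu] are. *)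
Lemma rank_one_update n (A S : 'M[R]_n) (w : 'cV[R]_n) (nu B : R) :
  0 <= B -> above_id A -> 0 <= nu -> form_bounded B S ->
  let A2 := A + nu *: (w *m w^T) in
  `|\tr (invmx A *m invmx A *m S) - \tr (invmx A2 *m invmx A2 *m S)| <= 3 * B.
Proof.
move=> B0 hA nu0 hS /=; set A2 := A + _; have uA := above_id_unit hA.
set G := invmx A; set v := G *m w.
have Gs : G^T = G by rewrite /G trmx_inv hA.1.
pose s := dot w v; pose c := nu / (1 + nu * s).
have vv : dot v v <= s by exact: above_id_inv_contract.
have vv0 := dot_ge0 v.
have s0 : 0 <= s by exact: le_trans vv0 vv.
have p0 : 0 < 1 + nu * s by have := mulr_ge0 nu0 s0; lra.
have c0 : 0 <= c by rewrite divr_ge0 // ltW.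
have cs : c * s <= 1.
  by rewrite /c mulrAC ler_pdivrMr // mul1r lerDr.
(* Sherman-Morrison *)
have -> : invmx A2 = G - c *: (v *m v^T).
  apply: invmx_unique; rewrite /A2 mulmxDl !mulmxBr mulmxV // -!scalemxAr.
  rewrite [A *m (v *m _)]mulmxA /v [A *m _]mulmxA mulmxV // mul1mx -/v -!scalemxAl.
  have -> : w *m w^T *m (v *m v^T) = s *: (w *m v^T).
    by rewrite mulmxA outer_mul -scalemxAl.
  have -> : w *m w^T *m G = w *m v^T by rewrite /v trmx_mul Gs mulmxA.
  rewrite !scalerA.
  rewrite -addrA -[RHS]addr0; congr (_ + _).
  rewrite -scaleNr -scalerBl -scalerDl.
  rewrite (_ : _ + _ = 0) ?scale0r // /c.
  by field; rewrite gt_eqF.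
rewrite -raddfB /= -mulmxBl.
have -> : G *m G - (G - c *: (v *m v^T)) *m (G - c *: (v *m v^T)) =
    c *: ((G *m v) *m v^T) + c *: (v *m (G *m v)^T) - (c ^+ 2 * dot v v) *: (v *m v^T).
  rewrite mulmxBl !mulmxBr -!scalemxAl -!scalemxAr.
  rewrite [(G *m v)^T]trmx_mul Gs [v *m v^T *m (v *m _)]mulmxA outer_mul -scalemxAl !scalerA !mulmxA -expr2.
  move: (G *m G) (G *m v *m v^T) (v *m v^T *m G) (v *m v^T) => X Y Z W.
  by apply/matrixP => i j; rewrite !mxE; ring.
rewrite mulmxBl mulmxDl -!scalemxAl raddfB raddfD /= !mxtraceZ !tr_outer.
have b1 := hS v (G *m v); have b2 := hS (G *m v) v; have b3 := hS v v.
have gg : dot (G *m v) (G *m v) <= dot v v by exact: above_id_inv_norm.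
have cv : c * dot v v <= 1 by apply: le_trans cs; rewrite ler_wpM2l.
set p := dot v (S *m (G *m v)) in b1 *; set q := dot (G *m v) _ in b2 *.
set r := dot v (S *m v) in b3 *.
set V := dot v v in vv0 cv gg b1 b2 b3 *.
have {}b1 : `|p| <= B * V by apply: le_trans b1 _; rewrite ler_wpM2l //; lra.
have {}b2 : `|q| <= B * V by apply: le_trans b2 _; rewrite ler_wpM2l //; lra.
have {}b3 : `|r| <= B * V by apply: le_trans b3 _; rewrite ler_wpM2l //; lra.
have cVB : c * (B * V) <= B by rewrite mulrCA ler_piMr.
have cV0 : 0 <= c * V by exact: mulr_ge0.
have h1 : `|c * p| <= B by rewrite normrM ger0_norm //; apply: le_trans cVB; rewrite ler_wpM2l.
have h2 : `|c * q| <= B by rewrite normrM ger0_norm //; apply: le_trans cVB; rewrite ler_wpM2l.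
have h3 : `|c ^+ 2 * V * r| <= B.
  rewrite (_ : _ * r = c * V * (c * r)); last by ring.
  rewrite normrM ger0_norm // -[leRHS]mul1r ler_pM // normrM ger0_norm //.
  by apply: le_trans cVB; rewrite ler_wpM2l.
apply: (le_trans (ler_normB _ _)).
have := ler_normD (c * p) (c * q); lra.
Qed.

(* The rows of index < m are dropped: for [D] the [d]-th cyclic difference
   matrix, [m = d] is the matrix of the penalized criterion and [m = 0] is a
   circulant. *)
Definition gram_from n (D : 'M[R]_n) (nu : R) m : 'M[R]_n :=
  1%:M + nu *: \sum_(i < n | (m <= i)%N) (row i D)^T *m row i D.

Lemma gram_from0 n (D : 'M[R]_n) nu : gram_from D nu 0 = 1%:M + nu *: (D^T *m D).
Proof.
congr (_ + _ *: _); apply/matrixP => i j; rewrite summxE mxE.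
by apply: eq_bigr => k _; rewrite mxE big_ord1 !mxE.
Qed.

Lemma gram_from_above n (D : 'M[R]_n) nu m : 0 <= nu -> above_id (gram_from D nu m).
Proof.
move=> nu0; split.
  rewrite /gram_from linearD linearZ /= trmx1 linear_sum; congr (_ + _ *: _).
  by apply: eq_bigr => i _; rewrite /= trmx_mul trmxK.
move=> x; rewrite /gram_from mulmxDl mul1mx dotDr lerDl -scalemxAl dotZr mulr_ge0 //.
rewrite mulmx_suml.
have -> : dot x (\sum_(i < n | (m <= i)%N) (row i D)^T *m row i D *m x) =
   \sum_(i < n | (m <= i)%N) dot (row i D)^T x ^+ 2.
  elim/big_rec2: _ => [|i y1 y2 _ <-]; first by rewrite /dot big1 // => j _; rewrite mxE mulr0.
  by rewrite dotDr -{2}[row i D]trmxK outer_mul dotZr (dotC x) expr2.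
by apply: sumr_ge0 => i _; rewrite sqr_ge0.
Qed.

Lemma gram_from_tr n (D S : 'M[R]_n) nu m B :
  0 <= B -> 0 <= nu -> form_bounded B S ->
  let G k := invmx (gram_from D nu k) in
  `|\tr (G m *m G m *m S) - \tr (G 0 *m G 0 *m S)| <= 3 * B *+ m.
Proof.
move=> B0 nu0 hS /=; set G := fun k => invmx (gram_from D nu k); rewrite -/(G m) -/(G 0);
  elim: m => [|m IH]; first by rewrite subrr normr0 mulr0n.
suff h : `|\tr (G m.+1 *m G m.+1 *m S) - \tr (G m *m G m *m S)| <= 3 * B.
  rewrite mulrSr.
  by rewrite (le_trans (ler_distD (\tr (G m *m G m *m S)) _ _)) // addrC lerD.
(* The number of dropped rows may exceed the dimension; past it nothing changes. *)
have [mn|nm] := ltnP m n; last first.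
  have -> : G m.+1 = G m.
    rewrite /G /gram_from; congr (invmx (_ + _ *: _)).
    by apply: eq_bigl => i; have := ltn_ord i; lia.
  by rewrite subrr normr0 mulr_ge0.
pose i0 := Ordinal mn.
have e : gram_from D nu m = gram_from D nu m.+1 + nu *: ((row i0 D)^T *m (row i0 D)^T^T).
  rewrite /gram_from (bigD1 i0) //= trmxK -addrA -scalerDr [X in _ + _ *: X = _]addrC.
  congr (_ + _ *: (_ + _)); apply: eq_bigl => i.
  by rewrite -val_eqE /= ltn_neqAle andbC eq_sym.
have -> : G m = invmx (gram_from D nu m.+1 + nu *: ((row i0 D)^T *m (row i0 D)^T^T)).
  by rewrite /G e.
by apply: rank_one_update => //; exact: gram_from_above.
Qed.

End Dot.

(** * Spectral decomposition of the circulant smoother *)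

Section Circulant.
Variable R : realType.

Lemma cos_period (x : R) (k : nat) : cos (x + 2 * pi * k%:R) = cos x.
Proof.
elim: k => [|k IH]; first by rewrite mulr0 addr0.
rewrite -[k.+1%:R]natr1 mulrDr mulr1 addrA.
have e : 2 * pi = pi *+ 2 :> R by rewrite mulr_natl.
by rewrite -[RHS]IH e cosD2pi.
Qed.

(** Multiplied by [2 sin a] with [a = pi m / n], the sum telescopes: [2 sin a cos (2 k a) = sin
    ((2k+1) a) - sin ((2k-1) a)], and the two ends agree modulo [2 pi]. The range of [m] makes
    [sin a] nonzero. *)
Lemma sum_cos_roots (n m : nat) : (0 < m < n)%N ->
  \sum_(k < n) cos (2 * pi * k%:R / n%:R * m%:R) = 0 :> R.
Proof.
move=> /andP[m0 mn].
have n0 : n%:R != 0 :> R by rewrite pnatr_eq0; lia.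
pose a : R := pi * m%:R / n%:R.
have sa : sin a != 0.
  rewrite gt_eqF // sin_gt0_pi // /a; have p0 := @pi_gt0 R.
  rewrite divr_gt0 ?mulr_gt0 ?ltr0n //=; last by lia.
  by rewrite ltr_pdivrMr ?ltr0n ?(leq_trans _ mn) // ltr_pM2l // ltr_nat.
apply: (mulfI (mulf_neq0 (_ : 2%:R != 0) sa)); first by rewrite pnatr_eq0.
rewrite mulr0 mulr_sumr.
under eq_bigr => k _.
  rewrite (_ : _ * cos _ = sin (k.+1%:R * (a *+ 2) - a) - sin (k%:R * (a *+ 2) - a));
    last first.
    rewrite (_ : 2 * pi * k%:R / n%:R * m%:R = k%:R * (a *+ 2)); last by rewrite /a; field.
    rewrite (_ : k.+1%:R * (a *+ 2) - a = k%:R * (a *+ 2) + a);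
      last by rewrite -natr1 -mulr_natl; ring.
    rewrite sinD sinB; ring.
  over.
rewrite -(big_mkord xpredT (fun k => sin (k.+1%:R * (a *+ 2) - a) - sin (k%:R * (a *+ 2) - a))).
rewrite telescope_sumr // mul0r add0r.
rewrite (_ : n%:R * (a *+ 2) - a = - a + 2 * pi * m%:R); last by rewrite /a -mulr_natl; field.
rewrite sinN opprK -[X in X + _]cosBpihalf addrAC cos_period cosBpihalf sinN addrC subrr //.
Qed.

Variable p : nat.
Local Notation n := p.+1.

(** Row 0 wraps around to the last entry. The [d]-th power therefore differs from the ordinary
    iterated difference only in the rows of index below [d]. *)
Definition diff_mx : 'M[R]_n := \matrix_(i, j) ((j == i)%:R - (j == ord_pred i)%:R).

Lemma sum_pick (T : finType) (F : T -> R) (a : T) : \sum_i (i == a)%:R * F i = F a.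
Proof.
rewrite (bigD1 a) //= eqxx mul1r big1 ?addr0 // => i /negPf ->.
by rewrite mul0r.
Qed.

Lemma diff_mxE (x : 'cV[R]_n) i : (diff_mx *m x) i 0 = x i 0 - x (ord_pred i) 0.
Proof.
rewrite mxE; under eq_bigr => j _ do rewrite mxE mulrBl.
by rewrite sumrB !sum_pick.
Qed.

Lemma tr_diff_mxE (x : 'cV[R]_n) i : (diff_mx^T *m x) i 0 = x i 0 - x (ordS i) 0.
Proof.
rewrite mxE; under eq_bigr => j _ do rewrite mxE mxE mulrBl.
rewrite sumrB; congr (_ - _).
  by under eq_bigr => j _ do rewrite eq_sym; rewrite sum_pick.
rewrite -(sum_pick (fun i => x i 0) (ordS i)); apply: eq_bigr => j _.
by congr (_%:R * _); rewrite eq_sym (can2_eq (@ord_predK _) (@ordSK _)).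
Qed.

Lemma ord_pred_val (i : 'I_n) : ord_pred i = (if i == 0 :> nat then p else i.-1) :> nat.
Proof.
rewrite /= addnS /=; case: i => -[|i] hi /=; first by rewrite modn_small.
by rewrite addSnnS modnDr modn_small // ltnW.
Qed.

Lemma iter_nabla_diff_mx d (x : 'cV[R]_n) (i : 'I_n) : (d <= i)%N ->
  iter d nabla (entry x) i.+1 = (diff_mx ^+ d *m x) i 0.
Proof.
have entryE (j : 'I_n) : entry x j.+1 = x j 0.
  by rewrite /entry (big_pred1 j) // => k; rewrite eqSS.
elim: d i => [|d IH] i; first by rewrite /= expr0 mul1mx entryE.
move=> di; rewrite iterS /nabla IH; last exact: ltnW.
rewrite exprS -mulmxA diff_mxE; congr (_ - _).
have e : i = (ord_pred i).+1 :> nat.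
  by rewrite ord_pred_val; move: di; case: (nat_of_ord i).
by rewrite [X in iter d _ _ X]/= [X in iter d _ _ X]e IH // -ltnS -e.
Qed.

(* Real waves with a free phase stand in for the complex exponentials: a
   difference multiplies a wave by [freq k] and shifts its phase. *)
Definition wave (k : nat) (phi : R) : 'cV[R]_n :=
  \col_i cos (2 * pi * k%:R / n%:R * (i : nat)%:R + phi).

(** For [k <= n] this is the modulus of [1 - e^(-i theta)], the transfer function of a difference,
    at [theta = 2 pi k / n]. *)
Definition freq (k : nat) : R := 2 * sin (pi * k%:R / n%:R).

Lemma diff_mx_wave k phi :
  diff_mx *m wave k phi = freq k *: wave k (phi + pi / 2 - pi * k%:R / n%:R).
Proof.
apply/matrixP => i j; rewrite (ord1 j) diff_mxE !mxE.
set a := pi * k%:R / n%:R.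
have n0 : n%:R != 0 :> R by rewrite pnatr_eq0.
have pE : p%:R = n%:R - 1 :> R by rewrite -natr1 addrK.
set t := 2 * pi * k%:R / n%:R * (i : nat)%:R.
have -> : cos (2 * pi * k%:R / n%:R * (ord_pred i : nat)%:R + phi) = cos (t + phi - (a + a)).
  (* In row 0 the predecessor is [n - 1], where the angle is off by [k] full turns: the frequency
     has to be a multiple of [2 pi / n]. *)
  rewrite ord_pred_val /t; case: ifP => [/eqP ->|i0].
    rewrite -[RHS](cos_period _ k) /a pE; congr cos.
    by field; rewrite addrC natr1.
  have -> : i.-1%:R = (i : nat)%:R - 1 :> R by rewrite -{2}(@prednK i) ?lt0n ?i0 //
    -[_.+1%:R]natr1 addrK.
  by rewrite /a; congr cos; field; rewrite addrC natr1.
rewrite (_ : t + (phi + pi / 2 - a) = t + phi - a + pi / 2); last by ring.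
rewrite cosDpihalf /freq -/a.
rewrite (_ : t + phi - (a + a) = t + phi - a - a); last by ring.
rewrite -{1}[t + phi](subrK a) cosD [cos (_ - _ - _)]cosB; ring.
Qed.

Lemma tr_diff_mx_wave k phi :
  diff_mx^T *m wave k phi = freq k *: wave k (phi - pi / 2 + pi * k%:R / n%:R).
Proof.
apply/matrixP => i j; rewrite (ord1 j) tr_diff_mxE !mxE.
set a := pi * k%:R / n%:R.
have n0 : n%:R != 0 :> R by rewrite pnatr_eq0.
have pE : p%:R = n%:R - 1 :> R by rewrite -natr1 addrK.
set t := 2 * pi * k%:R / n%:R * (i : nat)%:R.
have -> : cos (2 * pi * k%:R / n%:R * (ordS i : nat)%:R + phi) = cos (t + phi + a + a).
  have [hi|hi] := ltnP i.+1 n.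
    rewrite /= modn_small // /t /a -[i.+1%:R]natr1; congr cos.
    by field; rewrite addrC natr1.
  have ip : (i : nat) = p by apply/eqP; rewrite eqn_leq -ltnS ltn_ord.
  have -> : ordS i = 0 :> nat by rewrite /= ip modnn.
  rewrite /t ip mulr0 add0r -[LHS](cos_period _ k) /a pE; congr cos.
  by field; rewrite addrC natr1.
rewrite (_ : t + (phi - pi / 2 + a) = t + phi + a - pi / 2); last by ring.
rewrite cosBpihalf /freq -/a -{1}[t + phi](addrK a) cosB [cos (_ + a + a)]cosD; ring.
Qed.

(** The phase shifts of the difference and of its transpose are opposite, so a wave of any phase is
    an eigenvector of the product. *)
Lemma gram_wave d k phi :
  (diff_mx ^+ d)^T *m (diff_mx ^+ d *m wave k phi) = freq k ^+ (2 * d) *: wave k phi.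
Proof.
have Dd psi : diff_mx ^+ d *m wave k psi =
    freq k ^+ d *: wave k (psi + (pi / 2 - pi * k%:R / n%:R) *+ d).
  elim: d psi => [|d IH] psi; first by rewrite mul1mx scale1r mulr0n addr0.
  rewrite exprS -mulmxA IH -scalemxAr diff_mx_wave scalerA -exprSr; congr (_ *: wave _ _).
  by rewrite mulrSr; ring.
have Td psi : (diff_mx ^+ d)^T *m wave k psi =
    freq k ^+ d *: wave k (psi - (pi / 2 - pi * k%:R / n%:R) *+ d).
  elim: d psi {Dd} => [|d IH] psi; first by rewrite trmx1 mul1mx scale1r mulr0n subr0.
  rewrite exprSr trmx_mul -mulmxA IH -scalemxAr tr_diff_mx_wave scalerA -exprSr.
  by congr (_ *: wave _ _); rewrite mulrSr; ring.
by rewrite Dd -scalemxAr Td scalerA -exprD addrK mul2n -addnn.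
Qed.

(** Spectral synthesis without complex numbers: for [h] symmetric under [k -> n - k], this is the
    circulant with eigenvalue [h k] at frequency [2 pi k / n]. *)
Definition cos_kernel (h : nat -> R) : 'M[R]_n := \matrix_(i, j)
  (n%:R^-1 * \sum_(k < n) h k * cos (2 * pi * k%:R / n%:R * ((i : nat)%:R - (j : nat)%:R))).

Lemma cos_kernel1 : cos_kernel (fun=> 1) = 1%:M.
Proof.
have n0 : n%:R != 0 :> R by rewrite pnatr_eq0.
apply/matrixP => i j; rewrite !mxE; under eq_bigr => k _ do rewrite mul1r.
have [->|ij] := eqVneq i j.
  under eq_bigr => k _ do rewrite subrr mulr0 cos0.
  by rewrite sumr_const card_ord mulVf.
wlog ltji : i j ij / (j < i)%N => [hw|].
  move: (ij); rewrite -val_eqE neq_ltn => /orP[h|h]; last exact: hw.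
  rewrite -[RHS](hw j i) // 1?eq_sym //.
  by under eq_bigr => k _ do rewrite -cosN -mulrN opprB.
under eq_bigr => k _ do rewrite -(natrB _ (ltnW ltji)).
rewrite sum_cos_roots ?mulr0 // subn_gt0 ltji /=.
by rewrite (leq_ltn_trans (leq_subr _ _)).
Qed.

Lemma cos_kernel_col h j : col j (cos_kernel h) =
  n%:R^-1 *: \sum_(k < n) h k *: wave k (- (2 * pi * k%:R / n%:R * (j : nat)%:R)).
Proof.
apply/matrixP => i l; rewrite !mxE summxE; congr (_ * _).
by apply: eq_bigr => k _; rewrite !mxE mulrBr.
Qed.

Lemma circulant_cos_kernel d nu h :
  gram_from (diff_mx ^+ d) nu 0 *m cos_kernel h =
  cos_kernel (fun k => (1 + nu * freq k ^+ (2 * d)) * h k).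
Proof.

have e k phi : gram_from (diff_mx ^+ d) nu 0 *m wave k phi =
    (1 + nu * freq k ^+ (2 * d)) *: wave k phi.
  by rewrite gram_from0 mulmxDl mul1mx -scalemxAl -mulmxA gram_wave scalerA scalerDl scale1r.
apply/matrixP => i j.
have : col j (gram_from (diff_mx ^+ d) nu 0 *m cos_kernel h) =
       col j (cos_kernel (fun k => (1 + nu * freq k ^+ (2 * d)) * h k)).
  rewrite cos_kernel_col colE -mulmxA -colE cos_kernel_col -scalemxAr mulmx_sumr.
  congr (_ *: _); apply: eq_bigr => k _.
  by rewrite -scalemxAr e scalerA mulrC.
by move/matrixP => /(_ i 0); rewrite !mxE.
Qed.

Definition resp d (nu : R) k : R := (1 + nu * freq k ^+ (2 * d))^-1.

(** No product of two kernels is computed. The Gram matrix sends the kernel of [resp ^+ 2] to that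
    of [resp], and the latter to the identity, so applying its inverse twice to the identity gives
    the kernel of [resp ^+ 2]. *)
Lemma circulant_inv d nu : 0 <= nu ->
  invmx (gram_from (diff_mx ^+ d) nu 0) *m invmx (gram_from (diff_mx ^+ d) nu 0) =
  cos_kernel (fun k => resp d nu k ^+ 2).
Proof.
move=> nu0.
have pos k : 1 + nu * freq k ^+ (2 * d) != 0.
  by rewrite gt_eqF // ltr_pwDl // mulr_ge0 // exprM exprn_ge0 // sqr_ge0.
have e1 : gram_from (diff_mx ^+ d) nu 0 *m cos_kernel (resp d nu) = 1%:M.
  rewrite circulant_cos_kernel -cos_kernel1; congr cos_kernel; apply/funext => k.
  by rewrite mulfV.
have e2 : gram_from (diff_mx ^+ d) nu 0 *m cos_kernel (fun k => resp d nu k ^+ 2) = cos_kernel (resp d nu).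
  rewrite circulant_cos_kernel; congr cos_kernel; apply/funext => k.
  by rewrite expr2 mulVKf.
rewrite {2}(invmx_unique e1) -e2 mulmxA mulVmx ?mul1mx //.
exact/above_id_unit/gram_from_above.
Qed.

Lemma tr_circulant d nu (rho : int -> R) (S : 'M[R]_n) : 0 <= nu ->
  (forall i j, S i j = rho ((i : nat)%:Z - (j : nat)%:Z)) ->
  (forall j, rho (- j) = rho j) ->
  let G := invmx (gram_from (diff_mx ^+ d) nu 0) in
  \tr (G *m G *m S) = \sum_(k < n) resp d nu k ^+ 2 *
    (n%:R^-1 * \sum_(i < n) \sum_(j < n) rho ((i : nat)%:Z - (j : nat)%:Z) *
       cos (2 * pi * k%:R / n%:R * ((i : nat)%:Z - (j : nat)%:Z)%:~R)).
Proof.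
move=> nu0 hS rhoN; rewrite /= circulant_inv // /mxtrace.
pose f (i j : 'I_n) (k : 'I_n) := resp d nu k ^+ 2 * (n%:R^-1 *
  (rho ((i : nat)%:Z - (j : nat)%:Z) *
   cos (2 * pi * k%:R / n%:R * ((i : nat)%:Z - (j : nat)%:Z)%:~R))).
transitivity (\sum_i \sum_j \sum_k f i j k).
  apply: eq_bigr => i _; rewrite mxE; apply: eq_bigr => j _.
  have -> : S j i = rho ((i : nat)%:Z - (j : nat)%:Z) by rewrite hS -opprB rhoN.
  rewrite [cos_kernel _ _ _]mxE mulrAC mulr_sumr.
  apply: eq_bigr => k _; rewrite /f intrD intrN /= -!pmulrn; ring.
transitivity (\sum_i \sum_k \sum_j f i j k).
  by apply: eq_bigr => i _; exact: exchange_big.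
rewrite exchange_big /=; apply: eq_bigr => k _.
rewrite mulrA mulr_sumr; apply: eq_bigr => i _.
rewrite mulr_sumr; apply: eq_bigr => j _; rewrite /f. ring.
Qed.

End Circulant.

(** * Lag sums of an autocovariance sequence *)

Section Lags.
Variable R : realType.
Implicit Type q : int -> R.

Definition lagsum q (N : nat) : R := q 0 + 2 * \sum_(1 <= j < N.+1) q j%:Z.

Lemma lagsumS q N : lagsum q N.+1 = lagsum q N + 2 * q N.+1%:Z.
Proof. by rewrite /lagsum big_nat_recr //= mulrDr addrA. Qed.

Lemma sum_symmetric q N : (forall j, q (- j) = q j) ->
  \sum_(i < N.*2.+1) q ((i : nat)%:Z - N%:Z) = lagsum q N.
Proof.
move=> qN; elim: N => [|N IH].
  by rewrite big_ord1 /lagsum big_geq // mulr0 !addr0.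
rewrite doubleS big_ord_recr big_ord_recl /= lagsumS -IH.
under eq_bigr => i _.
  rewrite (_ : _ - _ = (i : nat)%:Z - N%:Z); last by rewrite /bump /=; lia.
  over.
rewrite (_ : 0%:Z - N.+1%:Z = - N.+1%:Z) ?qN; last by lia.
rewrite (_ : N.*2.+2%:Z - N.+1%:Z = N.+1%:Z); last by lia.
by ring.
Qed.

(** Enlarging the square from [n] to [n.+1] adds the corner [q 0] and two borders carrying the lags
    [1, ..., n], that is, [lagsum q n]. The double sum is thus [n] times a Cesaro mean of the lag
    sums. *)
Lemma double_sum_lags q n : (forall j, q (- j) = q j) ->
  \sum_(i < n) \sum_(j < n) q ((i : nat)%:Z - (j : nat)%:Z) = \sum_(m < n) lagsum q m.
Proof.
move=> qN; elim: n => [|n IH]; first by rewrite !big_ord0.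
have e : \sum_(i < n) q ((i : nat)%:Z - n%:Z) = \sum_(1 <= j < n.+1) q j%:Z.
  rewrite big_add1 /= big_nat_rev /= big_mkord; apply: eq_bigr => i _.
  by rewrite -qN; congr q; have := ltn_ord i; lia.
rewrite [RHS]big_ord_recr /= -IH big_ord_recr /=.
under eq_bigr => i _ do rewrite big_ord_recr /=.
rewrite big_split /= e big_ord_recr /= subrr.
have -> : \sum_(i < n) q (n%:Z - (i : nat)%:Z) = \sum_(1 <= j < n.+1) q j%:Z.
  by rewrite -e; apply: eq_bigr => i _; rewrite -qN opprB.
by rewrite /lagsum; ring.
Qed.

Lemma row_sum_lags q n i : (forall j, q (- j) = q j) -> (forall j, 0 <= q j) -> (i < n)%N ->
  \sum_(j < n) q (i%:Z - (j : nat)%:Z) <= lagsum q n.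
Proof.
move=> qN q0 lin.
have mono m : (m <= n)%N -> \sum_(1 <= j < m.+1) q j%:Z <= \sum_(1 <= j < n.+1) q j%:Z.
  by move=> mn; rewrite [leRHS](big_cat_nat (n := m.+1)) //= lerDl sumr_ge0.
rewrite -(big_mkord xpredT (fun j => q (i%:Z - j%:Z))) (big_cat_nat (n := i.+1)) //=.
rewrite /lagsum mulr_natl mulr2n addrA lerD //.
  rewrite big_nat_recr //= subrr addrC lerD2l.
  apply: le_trans (mono i (ltnW lin)).
  rewrite big_add1 big_nat_rev /= le_eqVlt; apply/orP; left; apply/eqP.
  by apply: eq_big_nat => j hj; congr q; lia.
apply: le_trans (mono (n - i.+1)%N _); last by lia.
rewrite -{1}[i.+1]add0n big_addn big_add1 /= le_eqVlt; apply/orP; left; apply/eqP.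
by apply: eq_big_nat => j hj; rewrite -qN; congr q; lia.
Qed.

(** [sumZ] is a [limn], which says nothing about a divergent sequence; convergence has to be
    supplied. *)
Lemma sum_symmetric_cvg q (S : R) : S = sumZ q -> (forall j, q (- j) = q j) ->
  cvgn (lagsum q) -> lagsum q N @[N --> \oo] --> S.
Proof.
move=> -> qN cv; rewrite /sumZ [X in limn X](_ : _ = lagsum q) //.
by apply/funext => N; rewrite sum_symmetric.
Qed.

Variables (rho : int -> R) (L : R).
Hypothesis rhoN : forall j, rho (- j) = rho j.
Hypothesis rhoL : forall N, \sum_(1 <= j < N) j%:R * `|rho j%:Z| <= L.

Lemma L_ge0 : 0 <= L.
Proof. by have := rhoL 0; rewrite big_geq. Qed.

Lemma sum_abs_le N : \sum_(1 <= j < N) `|rho j%:Z| <= L.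
Proof.
apply: le_trans (rhoL N); apply: ler_sum_nat => j /andP[h _].
by rewrite -[leLHS]mul1r ler_wpM2r // ler1n.
Qed.

Lemma lagsum_cvg : cvgn (lagsum rho).
Proof.
have h : cvgn (series (fun j => rho j.+1%:Z)).
  apply: normed_cvg; apply: nondecreasing_is_cvgn.
    by apply/nondecreasing_seqP => n; rewrite /= /series /= big_nat_recr //= lerDl.
  exists L => _ [n _ <-]; rewrite /= /series /=.
  by have := sum_abs_le n.+1; rewrite big_add1.
have -> : lagsum rho = (fun N => rho 0 + 2 * series (fun j => rho j.+1%:Z) N).
  by apply/funext => N; rewrite /lagsum /series /= big_add1.
by apply: is_cvgD; [exact: is_cvg_cst|apply: is_cvgM => //; exact: is_cvg_cst].
Qed.

(** Schur test: [|x y| <= (x^2 + y^2) / 2] entrywise, after which row sums and column sums of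
    [|rho|] remain. *)
Lemma toeplitz_form_bounded n (S : 'M[R]_n) :
  (forall i j, S i j = rho ((i : nat)%:Z - (j : nat)%:Z)) ->
  form_bounded (`|rho 0| + 2 * L) S.
Proof.
move=> hS x y.
have rb i : (i < n)%N -> \sum_(j < n) `|rho (i%:Z - (j : nat)%:Z)| <= `|rho 0| + 2 * L.
  move=> lin; apply: (le_trans (row_sum_lags (q := fun j => `|rho j|) _ _ lin)) => //.
    by move=> j; rewrite rhoN.
  by rewrite /lagsum lerD2l ler_wpM2l // sum_abs_le.
rewrite /dot; under eq_bigr => i _ do rewrite mxE mulr_sumr.
apply: (le_trans (ler_norm_sum _ _ _)).
have h : \sum_i `|\sum_j x i 0 * (S i j * y j 0)| <=
    \sum_(i < n) \sum_(j < n) `|rho ((i : nat)%:Z - (j : nat)%:Z)| * ((x i 0 ^+ 2 + y j 0 ^+ 2) / 2).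
  apply: ler_sum => i _; apply: (le_trans (ler_norm_sum _ _ _)); apply: ler_sum => j _.
  rewrite hS mulrCA normrM ler_wpM2l // normrM.
  rewrite -[x i 0 ^+ 2]real_normK ?num_real // -[y j 0 ^+ 2]real_normK ?num_real //.
  have := sqr_ge0 (`|x i 0| - `|y j 0|); nra.
apply: (le_trans h); rewrite mulrA ler_pdivlMr // mulr_suml mulrDr.
under eq_bigr => i _.
  rewrite mulr_suml; under eq_bigr => j _ do rewrite -mulrA divfK // mulrDr.
  rewrite big_split /=; over.
rewrite big_split /= lerD //.
  rewrite mulr_sumr; apply: ler_sum => i _; rewrite -mulr_suml -expr2 ler_wpM2r ?sqr_ge0 //.
  exact: rb.
rewrite exchange_big /= mulr_sumr; apply: ler_sum => i _;
  rewrite -mulr_suml -expr2 ler_wpM2r ?sqr_ge0 //.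
under eq_bigr => j _ do rewrite -rhoN opprB.
exact: rb.
Qed.

Lemma sin_natM_le (x : R) j : `|sin (j%:R * x)| <= j%:R * `|sin x|.
Proof.
elim: j => [|j IH]; first by rewrite !mul0r sin0 normr0.
rewrite -natr1 !mulrDl !mul1r sinD (le_trans (ler_normD _ _)) // lerD //.
  by rewrite normrM (le_trans _ IH) // ler_piMr // cos_max.
by rewrite normrM ler_piMl // cos_max.
Qed.

(** The bound uses [2 sin (t / 2)] instead of [t] because it must also be small for the frequencies
    near [2 pi], which mirror those near 0. *)
Lemma one_sub_cos_le (t : R) j : `|1 - cos (t * j%:R)| <= j%:R * `|2 * sin (t / 2)|.
Proof.
have -> : t * j%:R = (j%:R * (t / 2)) *+ 2 by rewrite -mulr_natl; field.
rewrite cos_mulr2n cos2sin2; set s := sin _.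
rewrite (_ : 1 - _ = 2 * s ^+ 2); last by rewrite -mulr_natl; ring.
rewrite !normrM normr_nat [leRHS]mulrCA ler_pM2l //.
by apply: le_trans (sin_natM_le _ _); rewrite ler_piMl // sin_max.
Qed.

(** Two errors: replacing the cosines by 1 costs [j |rho j| |2 sin (t / 2)|] per lag, and cutting
    the lags of the Cesaro mean costs a constant in total. *)
Lemma periodogram_mean n (t g0 : R) : lagsum rho N @[N --> \oo] --> g0 ->
  `|\sum_(i < n) \sum_(j < n) rho ((i : nat)%:Z - (j : nat)%:Z) *
       cos (t * ((i : nat)%:Z - (j : nat)%:Z)%:~R) - n%:R * g0|
  <= 2 * L * (n%:R * `|2 * sin (t / 2)| + 1).
Proof.
move=> cv.
have sc (c : R) : n%:R * c = \sum_(m < n) c by rewrite sumr_const card_ord mulr_natl.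
pose q (j : int) := rho j * cos (t * j%:~R).
rewrite (double_sum_lags (q := q)); last first.
  by move=> j; rewrite /q rhoN intrN mulrN cosN.
have d1 : `|\sum_(m < n) lagsum q m - \sum_(m < n) lagsum rho m| <= 2 * L * (n%:R * `|2 * sin (t / 2)|).
  rewrite -sumrB (le_trans (ler_norm_sum _ _ _)) //.
  rewrite mulrCA sc; apply: ler_sum => m _.
  rewrite /lagsum /q mulr0 cos0 mulr1 opprD addrACA subrr add0r -mulrBr -sumrB.
  rewrite normrM ger0_norm // -mulrA ler_wpM2l //.
  apply: (@le_trans _ _ (\sum_(1 <= j < m.+1) (j%:R * `|rho j%:Z|) * `|2 * sin (t / 2)|)).
    rewrite (le_trans (ler_norm_sum _ _ _)) //; apply: ler_sum => j _.
    rewrite -{2}[rho j%:Z]mulr1 -mulrBr normrM distrC mulrAC mulrC -pmulrn.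
    by rewrite ler_wpM2r // one_sub_cos_le.
  by rewrite -mulr_suml ler_wpM2r.
have d2 : `|\sum_(m < n) lagsum rho m - n%:R * g0| <= 2 * L.
  (* [g0] is approximated by [lagsum rho N] with [N >= n]; the bound does not depend on [N] and
     passes to the limit. *)
  apply: (@ler_cvg_to _ \oo _ _ (fun N => `|\sum_(m < n) lagsum rho m - n%:R * lagsum rho N|) (fun=> 2 * L)).
  - by apply: cvg_norm; apply: cvgB; [exact: cvg_cst|apply: cvgM => //; exact: cvg_cst].
  - exact: cvg_cst.
  near=> N; have nN : (n <= N)%N by near: N; exact: nbhs_infty_ge.
  rewrite sc -sumrB.
  (* Lag [j] is missing from [lagsum rho m] exactly when [m < j], hence at most [j] times over all
     [m]; this absorbs the weight [j]. *)
  apply: (@le_trans _ _ (\sum_(m < n) \sum_(1 <= j < N.+1) (m < j)%:R * (2 * `|rho j%:Z|))).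
    rewrite (le_trans (ler_norm_sum _ _ _)) //; apply: ler_sum => m _.
    rewrite /lagsum opprD addrACA subrr add0r -mulrBr (big_cat_nat (n := m.+1) (m := 1) (p := N.+1)) //=; last by have := ltn_ord m; lia.
    rewrite opprD addNKr mulrN normrN normrM ger0_norm //.
    rewrite [leRHS](big_cat_nat (n := m.+1)) //=; last by have := ltn_ord m; lia.
    rewrite [X in X + _]big_nat [X in X + _]big1 ?add0r.
      rewrite (le_trans (ler_wpM2l _ (ler_norm_sum _ _ _))) // mulr_sumr.
      apply: ler_sum_nat => j /andP[h _].
      by rewrite h mul1r.
    by move=> j h; rewrite ltnNge -ltnS (andP h).2 mul0r.
  rewrite exchange_big /=.
  apply: (@le_trans _ _ (\sum_(1 <= j < N.+1) 2 * (j%:R * `|rho j%:Z|))).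
    apply: ler_sum => j _; rewrite -mulr_suml mulrCA ler_wpM2l // ler_wpM2r //
      -natr_sum ler_nat.
    rewrite -(big_mkord xpredT (fun m => (m < j)%N : nat)) /=.
    apply: (@leq_trans (\sum_(0 <= m < j) 1)); last by rewrite sum_nat_const_nat subn0 muln1.
    have [nj|jn] := leqP n j.
      rewrite (big_cat_nat (n := n) (m := 0) (p := j)) //= (leq_trans _ (leq_addr _ _)) //.
      by apply: leq_sum => i _; case: (i < j)%N.
    rewrite (big_cat_nat (n := j)) //= ?(ltnW jn) //
      [X in (_ + X)%N]big_nat [X in (_ + X)%N]big1 ?addn0.
      by apply: leq_sum => i _; case: (i < j)%N.
    by move=> i /andP[h _]; rewrite ltnNge h.
  by rewrite -mulr_sumr ler_wpM2l.
rewrite mulrDr mulr1.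
by rewrite (le_trans (ler_distD (\sum_(m < n) lagsum rho m) _ _)) // lerD.
Unshelve. all: by end_near. Qed.

End Lags.

(** * The Beta integral as a limit of Riemann sums *)

Section BetaIntegral.
Variable R : realType.
Variable d : nat.
Hypothesis d_gt0 : (0 < d)%N.
Local Notation K := (2 * d)%N.
Local Notation mu := (@lebesgue_measure R).

(** The squared response of the circulant smoother at [x = v * freq k], when [nu = v ^+ (2 * d)]. *)
Definition kern (x : R) : R := (1 + x ^+ K) ^- 2.

Lemma oneDK_ge1 (x : R) : 1 <= 1 + x ^+ K.
Proof. by rewrite lerDl exprM exprn_ge0 // sqr_ge0. Qed.

Lemma oneDK_gt0 (x : R) : 0 < 1 + x ^+ K.
Proof. exact: lt_le_trans (oneDK_ge1 x). Qed.

Lemma kern_gt0 (x : R) : 0 < kern x.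
Proof. by rewrite /kern invr_gt0 exprn_gt0 // oneDK_gt0. Qed.

Lemma kern_le1 (x : R) : kern x <= 1.
Proof. by rewrite /kern invf_le1 ?exprn_gt0 ?oneDK_gt0 // exprn_ege1 // oneDK_ge1. Qed.

Lemma kern_anti (x y : R) : 0 <= x -> x <= y -> kern y <= kern x.
Proof.
move=> x0 xy; rewrite /kern lef_pV2 ?posrE ?exprn_gt0 ?oneDK_gt0 //.
rewrite ler_pXn2r ?nnegrE ?(ltW (oneDK_gt0 _)) // lerD2l ler_pXn2r ?nnegrE //; first lia.
exact: le_trans xy.
Qed.

Lemma kern_le_inv_sqr (x : R) : 0 < x -> kern x <= x ^- 2.
Proof.
move=> x0; rewrite /kern lef_pV2 ?posrE ?exprn_gt0 ?oneDK_gt0 //.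
rewrite ler_pXn2r ?nnegrE ?(ltW (oneDK_gt0 _)) ?(ltW x0) //.
have [x1|x1] := leP x 1.
  by rewrite (le_trans x1) // oneDK_ge1.
rewrite (le_trans _ (_ : x ^+ K <= _)) ?lerDr // -[leLHS]expr1 ler_weXn2l ?ltW //; lia.
Qed.

Lemma continuous_oneDK : continuous (fun x : R => 1 + x ^+ K).
Proof. by move=> x; apply: cvgD; [exact: cvg_cst|exact: exprn_continuous]. Qed.

Lemma continuous_kern : continuous kern.
Proof.
move=> x; apply: cvgV; first by rewrite expf_neq0 // gt_eqF // oneDK_gt0.
apply: (@continuous_comp _ _ _ (fun x : R => 1 + x ^+ K) (fun x => x ^+ 2)).
  exact: continuous_oneDK.
exact: exprn_continuous.
Qed.

Lemma kern_integrable (s t : R) : mu.-integrable `[s, t] (EFin \o kern).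
Proof.
apply: continuous_compact_integrable; first exact: segment_compact.
by apply: continuous_subspaceT; exact: continuous_kern.
Qed.

Definition kint (s t : R) : R := (\int[mu]_(x in `[s, t]) kern x)%R.

Lemma kint_split (s t u : R) : s <= t -> t <= u ->
  kint s u = kint s t + \int[mu]_(x in `]t, u]) kern x.
Proof.
move=> st tu; rewrite /kint -(@Rintegral_itvB _ kern (BLeft s) (BRight u) t).
- by rewrite addrC subrK.
- exact: kern_integrable.
- by rewrite bnd_simp.
- by rewrite bnd_simp.
Qed.

Lemma kern_piece (s t : R) : 0 <= s -> s <= t ->
  (t - s) * kern t <= \int[mu]_(x in `]s, t]) kern x <= (t - s) * kern s.
Proof.
move=> s0 st.
have ik : mu.-integrable `]s, t] (EFin \o kern).
  by apply: integrableS (kern_integrable s t) => //; exact: subset_itv_oc_cc.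
have ic (c : R) : mu.-integrable `]s, t] (EFin \o (fun _ : R => c)).
  have := @continuous_compact_integrable R (fun _ : R => c) `[s, t] (@segment_compact _ _ _).
  move=> /(_ (continuous_subspaceT _)) h.
  apply: integrableS (h _) => //; first exact: subset_itv_oc_cc.
  by move=> x; exact: cvg_cst.
have ci c : \int[mu]_(x in `]s, t]) c = (t - s) * c.
  have e : fine (mu `]s, t]%classic) = t - s.
    rewrite lebesgue_measure_itv /= lte_fin; case: ltP => [//|h].
    by apply/eqP; rewrite eq_sym subr_eq0 eq_le h st.
  by rewrite Rintegral_cst // mulrC -e.
apply/andP; split.
  rewrite -ci; apply: le_Rintegral => // x /=; rewrite in_itv /= => /andP[sx xt].
  by apply: kern_anti => //; exact: le_trans (ltW sx).
rewrite -ci; apply: le_Rintegral => // x /=; rewrite in_itv /= => /andP[sx xt].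
by apply: kern_anti => //; exact: ltW.
Qed.

Lemma kint_mono (s t u : R) : 0 <= s -> s <= t -> t <= u -> kint s t <= kint s u.
Proof.
move=> s0 st tu; rewrite (kint_split st tu) lerDl.
have /andP[+ _] := kern_piece (le_trans s0 st) tu; apply: le_trans.
by rewrite mulr_ge0 ?subr_ge0 // ltW // kern_gt0.
Qed.

Lemma kint_self (s : R) : kint s s = 0.
Proof. by rewrite /kint set_itv1 Rintegral_set1. Qed.

Lemma kint_riemann (a : R) N : 0 < a ->
  a * \sum_(1 <= k < N.+1) kern (a * k%:R) <= kint 0 (a * N%:R)
  <= a * \sum_(0 <= k < N) kern (a * k%:R).
Proof.
move=> a0; elim: N => [|N /andP[IH1 IH2]].
  by rewrite !big_geq // !mulr0 kint_self lexx.
have aN : 0 <= a * N%:R by rewrite mulr_ge0 // ltW.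
have aNS : a * N%:R <= a * N.+1%:R by rewrite ler_pM2l // ler_nat.
have e : a * N.+1%:R - a * N%:R = a by rewrite -natr1; ring.
have := kern_piece aN aNS; rewrite (kint_split aN aNS) e => /andP[h1 h2].
by rewrite (big_nat_recr N.+1 1) //= (big_nat_recr N 0) //= !mulrDr !lerD.
Qed.

(** The bound is uniform in [X], so that it survives in the improper integral. The summand [a] pays
    for the term [k = 0], and [(a * N%:R)^-1] for the terms beyond [N], through [kern x <= x^-2] and
    [1/(k+1)^2 <= 1/k - 1/(k+1)]. *)
Lemma kint_tail (a : R) N (X : R) : 0 < a -> (0 < N)%N ->
  kint 0 X <= a + a * \sum_(1 <= k < N.+1) kern (a * k%:R) + (a * N%:R)^-1.
Proof.
move=> a0 N0.
have tail M : a * \sum_(N.+1 <= k < (N + M).+1) kern (a * k%:R) <=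
    a^-1 * (N%:R^-1 - (N + M)%:R^-1).
  elim: M => [|M IH]; first by rewrite addn0 big_geq // subrr !mulr0.
  rewrite addnS big_nat_recr ?leq_addr //=.
  have p0 : 0 < (N + M)%:R :> R by rewrite ltr0n addn_gt0 N0.
  have p1 : 0 < (N + M).+1%:R :> R by rewrite ltr0n.
  have hk := kern_le_inv_sqr (mulr_gt0 a0 p1).
  rewrite mulrDr (le_trans (lerD IH (ler_wpM2l (ltW a0) hk))) //.
  rewrite -subr_ge0; move: p0 p1; rewrite -natr1; set y := (N + M)%:R => p0 p1.
  have n0 : N%:R != 0 :> R by rewrite pnatr_eq0 -lt0n.
  rewrite (_ : _ - _ = a^-1 * (y^-1 * (y + 1) ^- 2)); last first.
    by field; rewrite -natrD -/y n0 (gt_eqF p0) (gt_eqF p1) gt_eqF.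
  by rewrite mulr_ge0 ?mulr_ge0 ?invr_ge0 ?exprn_ge0 // ltW.
have [M hM] : exists M : nat, X <= a * (N + M)%:R.
  exists (Num.bound `|X / a|); rewrite mulrC -ler_pdivrMr //.
  apply: (le_trans (ler_norm _)); apply: ltW; apply: (lt_le_trans (archi_boundP _)) => //.
  by rewrite ler_nat leq_addl.
have NM : (0 < N + M)%N by rewrite addn_gt0 N0.
have [X0|X0] := ltP X 0.
  rewrite /kint set_itv_ge ?Rintegral_set0; last by rewrite bnd_simp -ltNge.
  rewrite !addr_ge0 ?mulr_ge0 ?sumr_ge0 ?invr_ge0 ?mulr_ge0 ?(ltW a0) // => k _.
  exact: ltW (kern_gt0 _).
rewrite (le_trans (kint_mono _ X0 hM)) //.
have /andP[_ h] := kint_riemann (N + M) a0.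
apply: (le_trans h); rewrite big_ltn // mulr0.
have k01 : kern 0 <= 1 := kern_le1 0.
rewrite mulrDr -addrA lerD //; first by rewrite ler_piMr // ltW.
rewrite (le_trans (_ : _ <= a * \sum_(1 <= k < (N + M).+1) kern (a * k%:R))) //.
  by rewrite ler_pM2l // [leRHS]big_nat_recr //= lerDl ltW // kern_gt0.
rewrite (big_cat_nat (n := N.+1)) //=; last by rewrite ltnS leq_addr.
rewrite mulrDr lerD2l (le_trans (tail M)) // invfM ler_wpM2l ?invr_ge0 ?(ltW a0) //.
by rewrite gerBl invr_ge0.
Qed.

End BetaIntegral.

Section BetaBounds.
Variable R : realType.
Variable d : nat.
Hypothesis d_gt0 : (0 < d)%N.
Local Notation K := (2 * d)%N.
Local Notation mu := (@lebesgue_measure R).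

Let b : R := K%:R^-1.
Let beta (x : R) : R := x `^ (b - 1) * (1 - x) `^ (2 - b - 1).
(* [subst t = t^K / (1 + t^K)], the change of variables taking [beta x dx] on ]0, 1[
   to [K * kern d t dt] on ]0, +oo[. *)
Let subst (t : R) : R := 1 - (1 + t ^+ K)^-1.

Let K_ge1 : (0 < K)%N. Proof. by rewrite muln_gt0. Qed.

Let K_gt0 : 0 < K%:R :> R. Proof. by rewrite ltr0n; lia. Qed.

Lemma is_derive_subst (t : R) :
  is_derive t 1 subst (kern d t * (K%:R * t ^+ K.-1)).
Proof.
have nz := lt0r_neq0 (oneDK_gt0 d t).
have dX : is_derive t (1 : R) (fun t : R => 1 + t ^+ K) (K%:R * t ^+ K.-1).
  have -> : (fun t : R => 1 + t ^+ K) = cst (1 : R) + (id ^+ K : R -> R).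
    by apply/funext => x; rewrite !fctE.
  have -> : K%:R * t ^+ K.-1 = 0 + (K%:R * t ^+ K.-1) *: (1 : R).
    by rewrite add0r [_ *: _]mulr1.
  by apply: is_deriveD; exact: is_deriveX.
have dV := is_deriveV (f := fun t : R => 1 + t ^+ K) nz dX.
have := is_deriveB (is_derive_cst (1 : R) t 1) dV.
by rewrite sub0r scaleNr opprK; apply.
Qed.

Lemma derive1_subst : subst^`()%classic = (fun t => kern d t * (K%:R * t ^+ K.-1)).
Proof.
apply/funext => t; have h := is_derive_subst t.
by rewrite derive1E derive_val.
Qed.

Lemma continuous_subst : continuous subst.
Proof.
move=> t; apply: differentiable_continuous; apply/derivable1_diffP.
exact: (@ex_derive _ _ _ _ _ _ _ (is_derive_subst t)).
Qed.

Lemma continuous_derive1_subst : continuous (subst^`()%classic).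
Proof.
rewrite derive1_subst => t; apply: cvgM; first exact: continuous_kern.
by apply: cvgM; [exact: cvg_cst|exact: exprn_continuous].
Qed.

Lemma subst_lt (s t : R) : 0 <= s -> s < t -> subst s < subst t.
Proof.
move=> s0 st; rewrite /subst ltrD2l ltrN2 ltf_pV2 ?posrE ?oneDK_gt0 //.
rewrite ltrD2l ltrXn2r // ?nnegrE ?(le_trans s0 (ltW st)) //; lia.
Qed.

Lemma subst_gt0 (t : R) : 0 < t -> 0 < subst t.
Proof.
move=> t0; rewrite (le_lt_trans _ (subst_lt (lexx 0) t0)) // /subst expr0n.
by rewrite (_ : (K == 0)%N = false) ?addr0 ?invr1 ?subrr //; lia.
Qed.

Lemma subst_lt1 (t : R) : subst t < 1.
Proof. by rewrite /subst gtrBl invr_gt0 oneDK_gt0. Qed.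

Lemma powR_continuous_gt0 (p x : R) : 0 < x -> {for x, continuous (fun y : R => y `^ p)}.
Proof.
move=> x0; apply: differentiable_continuous; apply/derivable1_diffP.
by apply: derivable_powR; rewrite in_itv /= x0.
Qed.

Lemma beta_continuous (x : R) : 0 < x < 1 -> {for x, continuous beta}.
Proof.
move=> /andP[x0 x1]; apply: cvgM; first exact: powR_continuous_gt0.
apply: (@continuous_comp _ _ _ (fun x : R => 1 - x) (fun y : R => y `^ (2 - b - 1))).
  by apply: cvgB; [exact: cvg_cst|exact: cvg_id].
by apply: powR_continuous_gt0; rewrite subr_gt0.
Qed.

(** With [w = 1 + t ^+ K] one has [subst t = t ^+ K / w] and [1 - subst t = 1 / w]. The two
    exponents of this Beta integrand are opposite, so the powers of [w] cancel, and what is left,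
    [t^(1 - K)], cancels against the derivative of [t ^+ K]. *)
Lemma beta_subst (t : R) : 0 < t -> beta (subst t) * (kern d t * (K%:R * t ^+ K.-1)) = K%:R * kern d t.
Proof.
move=> t0; rewrite [RHS]mulrC mulrCA; congr (_ * _).
set w := 1 + t ^+ K; have w0 : 0 < w := oneDK_gt0 d t.
have e1 : subst t = t ^+ K / w by rewrite /subst -/w /w; field; exact: lt0r_neq0.
have e2 : 1 - subst t = w^-1 by rewrite /subst -/w opprB addrC subrK.
rewrite /beta e2 e1 powRM ?exprn_ge0 ?invr_ge0 ?(ltW t0) ?(ltW w0) //.
have -> : 2 - b - 1 = - (b - 1) by ring.
rewrite (powRN _ (b - 1)) mulfK ?gt_eqF ?powR_gt0 ?invr_gt0 //.
have -> : (t ^+ K) `^ (b - 1) = t ^- K.-1.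
  rewrite -powR_mulrn ?(ltW t0) // -powRrM mulrBr mulfV ?gt_eqF // mulr1.
  rewrite -powR_invn ?(ltW t0) //; congr (_ `^ _).
  by rewrite -(@prednK K) ?muln_gt0 // -natr1; ring.
by rewrite mulrCA mulVf ?mulr1 // expf_neq0 // gt_eqF.
Qed.

(** The condition [0 < s] keeps the interval away from 0, where the integrand is singular; the upper
    end stays below 1. *)
Lemma beta_integral_subst (s t : R) : 0 < s -> s <= t ->
  (\int[mu]_(x in `[subst s, subst t]) (beta x)%:E = (K%:R * kint d s t)%:E)%E.
Proof.
move=> s0 st.
rewrite (@integration_by_substitution_increasing R subst beta s t) //.
- transitivity (\int[mu]_(x in `[s, t]) (K%:R%:E * (kern d x)%:E))%E.
    apply: eq_integral => x; rewrite inE /= in_itv /= => /andP[sx _].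
    rewrite -EFinM -beta_subst ?(lt_le_trans s0) // derive1_subst.
    by [].
  rewrite integralZl //; last exact: kern_integrable.
  by rewrite EFinM /kint /Rintegral fineK // integrable_fin_num //; exact: kern_integrable.
- move=> x y; rewrite !in_itv /= => /andP[sx _] _; apply: subst_lt.
  exact: le_trans (ltW s0) sx.
- by move=> x _; exact: continuous_derive1_subst.
- by apply/cvg_ex; exists (subst^`()%classic s); apply: cvg_at_right_filter;
  exact: continuous_derive1_subst.
- by apply/cvg_ex; exists (subst^`()%classic t); apply: cvg_at_left_filter;
  exact: continuous_derive1_subst.
- split.
  + by move=> x _; exact: (@ex_derive _ _ _ _ _ _ _ (is_derive_subst x)).
  + by apply: cvg_at_right_filter; exact: continuous_subst.
  + by apply: cvg_at_left_filter; exact: continuous_subst.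
- apply: continuous_in_subspaceT => x; rewrite inE /= in_itv /= => /andP[h1 h2].
  apply: beta_continuous; rewrite (lt_le_trans (subst_gt0 s0) h1).
  exact: le_lt_trans h2 (subst_lt1 t).
Qed.

Let F (m : nat) : set R := `[subst m.+1%:R^-1, subst m.+1%:R]%classic.

Lemma subst_le (s t : R) : 0 <= s -> s <= t -> subst s <= subst t.
Proof. by move=> s0; rewrite le_eqVlt => /predU1P[->//|/(subst_lt s0)/ltW]. Qed.

Lemma bigcup_F : \bigcup_m F m = `]0, 1[%classic.
Proof.
apply/seteqP; split => x.
  move=> [m _]; rewrite /F /= !in_itv /= => /andP[h1 h2].
  rewrite (lt_le_trans _ h1) ?subst_gt0 ?invr_gt0 //.
  exact: le_lt_trans h2 (subst_lt1 _).
rewrite /= in_itv /= => /andP[x0 x1].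
have xy0 : 0 < 1 - x by rewrite subr_gt0.
pose m := maxn (Num.bound x^-1) (Num.bound (1 - x)^-1).
have m0 : 0 < m.+1%:R :> R by [].
have m1 : 1 <= m.+1%:R :> R by rewrite ler1n.
have xm : x^-1 <= m.+1%:R.
  rewrite (le_trans (ltW (archi_boundP _))) ?invr_ge0 ?(ltW x0) // ler_nat.
  by rewrite leqW // leq_maxl.
have ym : (1 - x)^-1 <= m.+1%:R.
  rewrite (le_trans (ltW (archi_boundP _))) ?invr_ge0 ?(ltW xy0) // ler_nat.
  by rewrite leqW // leq_maxr.
exists m => //; rewrite /F /= in_itv /=; apply/andP; split.
  (* Left end: [subst s <= s ^+ K <= s <= x]. The right end uses
     [(1 - x)^-1 <= m.+1 <= 1 + m.+1 ^+ K]. *)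
  set s := m.+1%:R^-1.
  have s0 : 0 <= s by rewrite invr_ge0.
  have s1 : s <= 1 by rewrite invf_le1.
  have sx : s <= x by rewrite -[x]invrK lef_pV2 ?posrE ?invr_gt0.
  apply: le_trans sx; rewrite /subst lerBlDr -lerBlDl.
  have w1 := oneDK_ge1 d s.
  rewrite -[leRHS]div1r ler_pdivlMr ?oneDK_gt0 //.
  have sK : s ^+ K <= s by rewrite -[leRHS]expr1 ler_wiXn2l.
  have : 0 <= s ^+ K by rewrite exprn_ge0.
  nra.
rewrite /subst lerBrDr addrC -lerBrDr.
rewrite -[leRHS]invrK lef_pV2 ?posrE ?oneDK_gt0 ?invr_gt0 //.
apply: (le_trans ym); rewrite (le_trans _ (_ : m.+1%:R ^+ K <= _)) ?lerDr //.
by rewrite -[leLHS]expr1 ler_weXn2l.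
Qed.

Lemma beta_measurable (D : set (measurableTypeR R)) : measurable D ->
  measurable_fun D (fun x => (beta x)%:E).
Proof.
move=> mD; apply/measurable_EFinP; apply: measurable_funTS.
apply: measurable_funM; first exact: measurable_powR.
apply: (@measurableT_comp _ _ _ _ _ _ (fun y : R => y `^ (2 - b - 1)));
  first exact: measurable_powR.
by apply: measurable_funB => //.
Qed.

(** Monotone convergence along a compact exhaustion of []0, 1[], stated in the extended reals since
    the Beta integral is not yet known to be finite. *)
Lemma beta_integral_cvg :
  (K%:R * kint d m.+1%:R^-1 m.+1%:R)%:E @[m --> \oo] --> (\int[mu]_(x in `[0%R, 1%R]) (beta x)%:E)%E.
Proof.
rewrite integral_itv_bndoo; last exact: beta_measurable.
rewrite -bigcup_F.
have h m : (K%:R * kint d m.+1%:R^-1 m.+1%:R)%:E = (\int[mu]_(x in F m) (beta x)%:E)%E.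
  rewrite /F beta_integral_subst ?invr_gt0 //.
  by rewrite (@le_trans _ _ 1) ?invf_le1 ?ler1n.
under eq_fun do rewrite h.
apply: ge0_nondecreasing_set_cvg_integral.
- move=> m n mn; rewrite subsetEset /F; apply: subset_itv;
  rewrite bnd_simp subst_le ?invr_ge0 //.
    by rewrite lef_pV2 ?posrE // ler_nat.
  by rewrite ler_nat.
- by move=> m; exact: measurable_itv.
- by move=> m; apply: beta_measurable; exact: measurable_itv.
- by move=> m x _; rewrite lee_fin mulr_ge0 ?powR_ge0.
Qed.

Lemma Beta_riemann (a : R) N : 0 < a -> (0 < N)%N ->
  a * \sum_(1 <= k < N.+1) kern d (a * k%:R) <= Beta b (2 - b) / K%:R
  <= a + a * \sum_(1 <= k < N.+1) kern d (a * k%:R) + (a * N%:R)^-1.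
Proof.
move=> a0 N0; have cv := beta_integral_cvg.
set S := a * \sum_(1 <= k < N.+1) _; set I := (\int[mu]_(x in _) _)%E in cv.
have split0 (s t : R) : 0 <= s -> s <= t -> kint d 0 t = kint d 0 s + kint d s t.
  by move=> s0 st; rewrite (kint_split d s0 st) (kint_split d (lexx s) st) kint_self add0r.
have inv_le m : m.+1%:R^-1 <= m.+1%:R :> R.
  by rewrite (@le_trans _ _ 1) ?invf_le1 ?ler1n.
have kint_ge0 (s : R) : 0 <= s -> 0 <= kint d 0 s.
  by move=> s0; have := kint_mono d_gt0 (lexx 0) (lexx 0) s0; rewrite kint_self.
have kint_le (s : R) : 0 <= s -> kint d 0 s <= s.
  move=> s0; rewrite (kint_split d (lexx 0) s0) kint_self add0r.
  have /andP[_ h] := kern_piece d_gt0 (lexx 0) s0; apply: (le_trans h).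
  by rewrite subr0 ler_piMr // kern_le1.
have upper : (I <= (K%:R * (a + S + (a * N%:R)^-1))%:E)%E.
  apply: cvge_le cv; near=> m; rewrite lee_fin ler_pM2l //.
  apply: le_trans (kint_tail d_gt0 m.+1%:R a0 N0).
  by rewrite (@split0 m.+1%:R^-1) ?invr_ge0 // lerDr kint_ge0 // invr_ge0.
(* The loss [e] covers the missing piece [[0, 1/(m+1)]], of integral at most its length since
   [kern <= 1]. *)
have lower e : 0 < e -> ((K%:R * (S - e))%:E <= I)%E.
  move=> e0; apply: cvge_ge cv; near=> m; rewrite lee_fin ler_pM2l // lerBlDr.
  have /andP[+ _] := kint_riemann d_gt0 N a0; rewrite -/S => /le_trans; apply.
  have aNm : a * N%:R <= m.+1%:R.
    rewrite ltW // (lt_le_trans (archi_boundP _)) ?mulr_ge0 ?(ltW a0) // ler_nat leqW //.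
    by near: m; exact: nbhs_infty_ge.
  have em : m.+1%:R^-1 <= e.
    rewrite -[e]invrK lef_pV2 ?posrE ?invr_gt0 //.
    rewrite ltW // (lt_le_trans (archi_boundP _)) ?invr_ge0 ?(ltW e0) // ler_nat leqW //.
    by near: m; exact: nbhs_infty_ge.
  have aN0 : 0 <= a * N%:R by rewrite mulr_ge0 // ltW.
  apply: (le_trans (kint_mono d_gt0 (lexx 0) aN0 aNm)).
  rewrite (@split0 m.+1%:R^-1) ?invr_ge0 // addrC lerD2l.
  by apply: le_trans em; rewrite kint_le // invr_ge0.
(* Only these two bounds make the integral finite, so that its real-valued version [Beta] carries
   its value. *)
have BI : I = (Beta b (2 - b))%:E.
  rewrite /Beta /Rintegral fineK // fin_numE; apply/andP; split.
    by rewrite gt_eqF // (lt_le_trans _ (lower _ ltr01)) // ltNyr.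
  by rewrite lt_eqF // (le_lt_trans upper) // ltry.
move: upper lower; rewrite BI lee_fin => upper lower.
rewrite ler_pdivlMr // ler_pdivrMr // mulrC [X in _ && (_ <= X)]mulrC upper andbT.
apply/ler_addgt0Pl => e e0.
have := lower (e / K%:R) (divr_gt0 e0 K_gt0);
  rewrite lee_fin mulrBr [K%:R * (e / _)]mulrC divfK ?gt_eqF //.
by rewrite lerBlDr addrC.
Unshelve. all: by end_near. Qed.

End BetaBounds.

(** * Sums over the Fourier frequencies *)

Section RiemannSums.
Variable R : realType.

Lemma sin_le_id (u : R) : 0 <= u -> sin u <= u.
Proof.
rewrite le_eqVlt => /predU1P[<-|u0]; first by rewrite sin0.
have [c _] := MVT u0 (fun x _ => is_derive_sin x) (continuous_subspaceT (@continuous_sin R)).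
rewrite sin0 !subr0 => ->.
by rewrite ler_piMl ?(ltW u0) // cos_le1.
Qed.

(** Half-angle formula and [sin w <= w] at [w = u / 2]. If [sin w] is negative then [w > 1], and
    [sin w ^+ 2 <= 1] suffices. *)
Lemma cos_ge_parabola (u : R) : 0 <= u -> 1 - u ^+ 2 / 2 <= cos u.
Proof.
move=> u0.
have -> : u = (u / 2) *+ 2 by rewrite -mulr_natl; field.
set w := u / 2; have w0 : 0 <= w by rewrite divr_ge0.
rewrite cos_mulr2n cos2sin2 -mulr_natl.
have s1 := sin_le_id w0; have [s0|s0] := leP 0 (sin w); first by nra.
have : 0 <= 1 + sin w by rewrite -lerBlDl sub0r sin_geN1.
have [w1|w1] := leP w 1; last by nra.
suff : 0 <= sin w by rewrite leNgt s0.
by rewrite sin_ge0_pi // w0 (le_trans w1) // (le_trans _ (@pi_ge2 R)) // ler1n.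
Qed.

Lemma sin_ge_cubic (u : R) : 0 <= u -> u - u ^+ 3 / 6 <= sin u.
Proof.
rewrite le_eqVlt => /predU1P[<-|u0]; first by rewrite sin0 expr0n mul0r subr0.
pose f (x : R) := sin x + (6^-1 * x ^+ 3 - x).
have df (x : R) : is_derive x (1 : R) f (cos x + (6^-1 * (3 * x ^+ 2) - 1)).
  rewrite /f.
  have -> : (fun x : R => sin x + (6^-1 * x ^+ 3 - x)) = (sin : R -> R) + ((6^-1 : R) \*: (id ^+ 3 : R -> R) - id).
    by apply/funext => y; rewrite !fctE.
  have -> : 6^-1 * (3 * x ^+ 2) = (6^-1 : R) *: ((3 * x ^+ 2) *: (1 : R)).
    by rewrite [3 * _ *: _]mulr1.
  apply: is_deriveD; apply: is_deriveB; apply: is_deriveZ; exact: is_deriveX.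
have cf : {within `[0, u], continuous f}.
  apply: continuous_subspaceT => x; apply: differentiable_continuous; apply/derivable1_diffP.
  exact: (@ex_derive _ _ _ _ _ _ _ (df x)).
have [c] := MVT u0 (fun x _ => df x) cf.
rewrite in_itv /= => /andP[c0 _].
have cc := cos_ge_parabola (ltW c0).
rewrite {1 2}/f sin0 expr0n mulr0 subr0 addr0 !subr0 => e.
have : 0 <= (cos c + (6^-1 * (3 * c ^+ 2) - 1)) * u by rewrite mulr_ge0 ?(ltW u0) //; lra.
rewrite -e; lra.
Qed.

Lemma bernoulli_pow (r : R) m : 0 <= r <= 1 -> 1 - r ^+ m <= m%:R * (1 - r).
Proof.
move=> /andP[r0 r1]; elim: m => [|m IH]; first by rewrite expr0 subrr mul0r.
have h : r ^+ m <= 1 by rewrite exprn_ile1.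
rewrite exprS -[m.+1%:R]natr1; nra.
Qed.

(* Compares the sine frequency [y] with the linear one [x] of which it is a
   small relative perturbation. *)
Lemma kern_diff_le d (y x : R) : 0 <= y -> y <= x -> 0 < x ->
  kern d y - kern d x <= 2 * (2 * d)%:R * (1 - y / x) * kern d y.
Proof.
move=> y0 yx x0.
have r01 : 0 <= y / x <= 1 by rewrite divr_ge0 ?(ltW x0) //= ler_pdivrMr // mul1r.
have hb := bernoulli_pow (2 * d) r01.
have p0 : 0 <= y ^+ (2 * d) by rewrite exprn_ge0.
have q0 : 0 < x ^+ (2 * d) by rewrite exprn_gt0.
have pq : y ^+ (2 * d) <= x ^+ (2 * d) by apply: lerXn2r => //; rewrite nnegrE // ltW.
have r0 : 0 <= 1 - (y / x) ^+ (2 * d) by case/andP: r01 => r0 r1; rewrite subr_ge0 exprn_ile1.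
apply: (@le_trans _ _ (2 * (1 - (y / x) ^+ (2 * d)) * kern d y)); last first.
  by rewrite ler_wpM2r ?(ltW (kern_gt0 _ _)) // -mulrA ler_wpM2l.
rewrite expr_div_n /kern.
set p := y ^+ _ in p0 pq *; set q := x ^+ _ in q0 pq *.
have P0 : 0 < 1 + p by lra.
have Q0 : 0 < 1 + q by lra.
rewrite -subr_ge0.
(* After factoring, it remains to see that [2 (1 + q)^2 / q >= 2 + p + q], which follows from
   [p <= q]. *)
have -> : 2 * (1 - p / q) * (1 + p) ^- 2 - ((1 + p) ^- 2 - (1 + q) ^- 2) =
   (1 + p) ^- 2 * (1 + q) ^- 2 * ((q - p) * (2 * (1 + q) ^+ 2 / q - (2 + p + q))).
  by field; rewrite !gt_eqF.
rewrite !mulr_ge0 ?invr_ge0 ?exprn_ge0 ?(ltW P0) ?(ltW Q0) ?subr_ge0 //.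
rewrite ler_pdivlMr //; nra.
Qed.

(** The majorant has no singularity at 0 and, along an arithmetic progression, a sum bounded by
    telescoping uniformly in the number of terms. *)
Lemma id_kern_le d (s : R) : (0 < d)%N -> 0 <= s -> s * kern d s <= 4 / (1 + s) ^+ 2.
Proof.
move=> d0 s0.
have w0 := oneDK_gt0 d s; have s1 : 0 < 1 + s by lra.
rewrite /kern ler_pdivlMr ?exprn_gt0 // mulrAC ler_pdivrMr ?exprn_gt0 //.
have [sl|sl] := leP s 1.
  have w1 : 1 <= (1 + s ^+ (2 * d)) ^+ 2 by rewrite exprn_ege1 // oneDK_ge1.
  apply: (@le_trans _ _ 4); nra.
have : s ^+ 2 <= s ^+ (2 * d) by rewrite ler_weXn2l ?(ltW sl) //; lia.
set q := s ^+ (2 * d) => hq.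
have : (s ^+ 2) ^+ 2 <= (1 + q) ^+ 2.
  by apply: lerXn2r; rewrite ?nnegrE; nra.
nra.
Qed.

Lemma sum_inv_sqr_le (c : R) N : 0 < c ->
  \sum_(1 <= k < N.+1) (1 + c * k%:R) ^- 2 <= c^-1.
Proof.
move=> c0.
suff : \sum_(1 <= k < N.+1) (1 + c * k%:R) ^- 2 <= c^-1 * (1 - (1 + c * N%:R)^-1).
  move=> /le_trans; apply; rewrite ler_piMr ?invr_ge0 ?(ltW c0) // gerBl invr_ge0.
  by rewrite addr_ge0 // mulr_ge0 // ltW.
elim: N => [|N IH]; first by rewrite big_geq // mulr0 addr0 invr1 subrr mulr0.
rewrite big_nat_recr //=.
have w0 : 0 < 1 + c * N%:R by rewrite ltr_pwDl // mulr_ge0 // ltW.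
have e : 1 + c * N.+1%:R = 1 + c * N%:R + c by rewrite -natr1; ring.
have w1 : 0 < 1 + c * N.+1%:R by rewrite e addr_gt0.
have h : (1 + c * N.+1%:R) ^- 2 <= c^-1 * ((1 + c * N%:R)^-1 - (1 + c * N.+1%:R)^-1).
  rewrite e in w1 *; set w := 1 + c * N%:R in w0 w1 *.
  rewrite -subr_ge0.
  have -> : c^-1 * (w^-1 - (w + c)^-1) - (w + c) ^- 2 = c * (w^-1 * (w + c) ^- 2).
    by field; rewrite !gt_eqF.
  by rewrite !mulr_ge0 ?invr_ge0 ?exprn_ge0 ?(ltW w0) ?(ltW w1) ?(ltW c0).
apply: (le_trans (lerD IH h)); rewrite -mulrDr ler_pM2l ?invr_gt0 //; lra.
Qed.

(** Frequencies pair up as [k] and [p.+1 - k]. The index 0 stays alone, and so does the middle index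
    when [p] is odd; these two terms give [2 * M]. *)
Lemma sum_reflect_le (f : nat -> R) (M : R) p :
  (forall k, (k <= p)%N -> 0 <= f k <= M) ->
  (forall k, (0 < k <= p)%N -> f (p.+1 - k)%N = f k) ->
  2 * \sum_(1 <= k < p./2.+1) f k <= \sum_(k < p.+1) f k
    <= 2 * \sum_(1 <= k < p./2.+1) f k + 2 * M.
Proof.
move=> fM fsym; set N := p./2.
have pN : p = (odd p + (N + N))%N by rewrite addnn odd_double_half.
have e1 : \sum_(p - N + 1 <= k < p.+1) f k = \sum_(1 <= k < N.+1) f k.
  rewrite [RHS]big_nat_rev /= addnC big_addn (_ : (p.+1 - (p - N) = N.+1)%N); last by lia.
  apply: eq_big_nat => k hk; rewrite -fsym; last by lia.
  by congr f; lia.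
have e2 : 0 <= \sum_(N.+1 <= k < p - N + 1) f k <= M.
  have M0 : 0 <= M by have /andP[h1 h2] := fM 0 (leq0n _); exact: le_trans h2.
  have [hp|hp] := boolP (odd p).
    rewrite (_ : (p - N + 1 = N.+2)%N); last by lia.
    by rewrite big_nat1 fM //; lia.
  by rewrite big_geq ?lexx //; lia.
have e0 := fM 0 (leq0n _).
rewrite -(big_mkord xpredT f) big_ltn //
  (big_cat_nat (n := N.+1) (m := 1) (p := p.+1)) //=; last by lia.
rewrite (big_cat_nat (n := (p - N + 1)%N) (m := N.+1) (p := p.+1)) //=; [|by lia|by lia].
rewrite e1; move: e0 e2 => /andP[? ?] /andP[? ?]; lra.
Qed.

Section Freq.
Variables (d p : nat) (v : R).
Hypotheses (d0 : (0 < d)%N) (v0 : 0 < v).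
Local Notation n := p.+1.
Local Notation n' := (n%:R : R).
Let step : R := 2 * pi * v / n'.
Let E k := kern d (v * freq R p k).
Let theta (k : nat) : R := 2 * pi * k%:R / n'.

Let n0 : 0 < n'. Proof. by rewrite ltr0n. Qed.
Let pi0 : 0 < pi :> R. Proof. exact: pi_gt0. Qed.
Let step0 : 0 < step. Proof. by rewrite divr_gt0 // !mulr_gt0. Qed.

Let half_le : (p./2 <= n)%N. Proof. by lia. Qed.

Lemma freq_reflect k : (k <= n)%N -> freq R p (n - k) = freq R p k.
Proof.
move=> kn; rewrite /freq natrB // mulrBr mulrBl mulfK ?gt_eqF //.
by rewrite sinB sinpi cospi mul0r mulN1r sub0r opprK.
Qed.

(** The lower bound is the cubic bound for the sine at [theta k / 2]. The bound 4 replaces [pi]: it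
    is crude, yet it keeps [1 - theta ^+ 2 / 24 >= 1/3], so that [freq] is at least a third of
    [theta]. *)
Lemma freq_bounds k : (k <= p./2)%N ->
  0 <= theta k <= 4 /\ theta k * (1 - theta k ^+ 2 / 24) <= freq R p k <= theta k.
Proof.
move=> kp.
have k0 : 0 <= theta k by rewrite divr_ge0 ?mulr_ge0 ?(ltW n0) ?(ltW pi0).
have k4 : theta k <= 4.
  rewrite /theta ler_pdivrMr //.
  have : k%:R * 2 <= n' by rewrite -natrM ler_nat; lia.
  have pk : pi * k%:R <= 4 * k%:R :> R.
    by rewrite ler_wpM2r //; have := @pihalf_lt2 R; lra.
  lra.
split; first by rewrite k0.
have e : pi * k%:R / n' = theta k / 2 by rewrite /theta; field; rewrite addrC natr1 gt_eqF.
rewrite /freq e.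
have h : 0 <= theta k / 2 by rewrite divr_ge0.
have := sin_le_id h; have := sin_ge_cubic h; set s := sin _; lra.
Qed.

Lemma freq_ge0 k : (k <= n)%N -> 0 <= freq R p k.
Proof.
move=> kn; rewrite mulr_ge0 // sin_ge0_pi // divr_ge0 ?mulr_ge0 ?(ltW n0) ?(ltW pi0) //=.
by rewrite ler_pdivrMr // ler_wpM2l ?(ltW pi0) // ler_nat.
Qed.

Lemma theta_kern_le k : (k <= p./2)%N ->
  theta k * E k <= 12 / v * (1 + step / 3 * k%:R) ^- 2.
Proof.
move=> kp; have [/andP[t0 t4] /andP[y1 y2]] := freq_bounds kp.
set s := step / 3 * k%:R.
have es : s = v * theta k / 3 by rewrite /s /step /theta; field; rewrite addrC natr1 gt_eqF.
have s0 : 0 <= s by rewrite es divr_ge0 // mulr_ge0 // ltW.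
have sy : s <= v * freq R p k.
  rewrite es -mulrA ler_wpM2l ?(ltW v0) //; apply: le_trans y1.
  rewrite ler_wpM2l //; nra.
have h1 : E k <= kern d s by exact: kern_anti.
have h2 := id_kern_le d0 s0.
apply: (@le_trans _ _ (3 / v * (s * kern d s))).
  rewrite mulrA (_ : 3 / v * s = theta k); last by rewrite es; field; exact: lt0r_neq0.
  by rewrite ler_wpM2l.
rewrite (_ : 12 / v * _ = 3 / v * (4 / (1 + s) ^+ 2)); last by field; rewrite !gt_eqF //; lra.
by rewrite ler_wpM2l // divr_ge0 // ltW.
Qed.

(** The first moment of the kernel, source of the frequency-proportional errors [n / v ^+ 2]. The
    constant is [(12 / v) * (3 / step) = (18 / pi) * n / v ^+ 2], with [pi >= 2]. *)
Lemma sum_theta_kern : \sum_(1 <= k < p./2.+1) theta k * E k <= 9 * (n' / v ^+ 2).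
Proof.
apply: (@le_trans _ _ (\sum_(1 <= k < p./2.+1) 12 / v * (1 + step / 3 * k%:R) ^- 2)).
  by apply: ler_sum_nat => k /andP[_ kp]; apply: theta_kern_le.
rewrite -mulr_sumr.
have c0 : 0 < step / 3 by rewrite divr_gt0.
apply: (le_trans (ler_wpM2l _ (sum_inv_sqr_le _ c0))); first by rewrite divr_ge0 // ltW.
rewrite (_ : 12 / v * (step / 3)^-1 = 18 / pi * (n' / v ^+ 2)); last first.
  by rewrite /step; move: n' n0 (pi : R) pi0 => m m0 q q0; field; rewrite !gt_eqF.
rewrite ler_wpM2r ?divr_ge0 ?exprn_ge0 ?(ltW v0) ?(ltW n0) //.
rewrite ler_pdivrMr //; have := @pi_ge2 R; lra.
Qed.

(** The relative defect of the sine frequency is at most [theta ^+ 2 / 24 <= theta / 6]; the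
    comparison of kernels multiplies it by [4 d], and [4 / 6 <= 1]. *)
Lemma kern_freq_diff k : (0 < k <= p./2)%N ->
  0 <= E k - kern d (step * k%:R) <= d%:R * (theta k * E k).
Proof.
move=> /andP[k0 kp]; have [/andP[t0 t4] /andP[y1 y2]] := freq_bounds kp.
have tpos : 0 < theta k by rewrite divr_gt0 // !mulr_gt0 // ltr0n.
have es : step * k%:R = v * theta k by rewrite /step /theta; field; rewrite addrC natr1 gt_eqF.
have y0 : 0 <= freq R p k by rewrite freq_ge0 // (leq_trans kp) // half_le.
rewrite es; have vy0 : 0 <= v * freq R p k by rewrite mulr_ge0 // ltW.
have vyx : v * freq R p k <= v * theta k by rewrite ler_wpM2l // ltW.
apply/andP; split; first by rewrite subr_ge0; apply: kern_anti.
apply: (le_trans (kern_diff_le d vy0 vyx (mulr_gt0 v0 tpos))).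
rewrite mulrA ler_wpM2r ?(ltW (kern_gt0 _ _)) //.
rewrite natrM mulrA -mulrA mulrAC [leLHS]mulrC mulrA.
rewrite (_ : v * freq R p k / (v * theta k) = freq R p k / theta k); last first.
  by field; rewrite !gt_eqF.
have hr : 1 - freq R p k / theta k <= theta k / 6.
  rewrite lerBlDl -lerBlDr ler_pdivlMr //; apply: le_trans y1; nra.
have d1 : 0 <= d%:R :> R by [].
nra.
Qed.

Lemma sum_kern_freq : (2 <= p)%N ->
  `|\sum_(k < n) kern d (v * freq R p k) -
    n' * (Beta (2 * d)%:R^-1 (2 - (2 * d)%:R^-1) / (2 * d)%:R) / (pi * v)|
  <= (18 * d%:R + 1) * (n' / v ^+ 2) + 4.
Proof.
(* Half of the frequencies is at least [n / 4] of them, so the Riemann sum reaches far enough for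
   its tail to cost at most [Q / 4]. *)
move=> p2; have p4 : (p.+1 <= p./2 * 4)%N by lia.
set J := _ / (2 * d)%:R; set Q := n' / v ^+ 2.
have N0 : (0 < p./2)%N by rewrite half_gt0.
have fM k : (k <= p)%N -> 0 <= E k <= 1 by rewrite (ltW (kern_gt0 _ _)) kern_le1.
have fsym k : (0 < k <= p)%N -> E (p.+1 - k)%N = E k.
  by move=> kp; rewrite /E freq_reflect //; lia.
have := sum_reflect_le fM fsym; have := Beta_riemann d0 step0 N0; rewrite -/J.
set S1 := \sum_(1 <= k < p./2.+1) E k; set S2 := \sum_(1 <= k < p./2.+1) _.
set S := \sum_(k < n) E k => /andP[j1 j2] /andP[s1 s2].
have S12 : 0 <= S1 - S2 <= d%:R * (9 * Q).
  rewrite -sumrB; apply/andP; split.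
    rewrite big_nat_cond sumr_ge0 // => k /andP[/andP[k1 k2] _].
    by have /andP[] : 0 <= E k - kern d (step * k%:R) <= d%:R * (theta k * E k) by apply/kern_freq_diff/andP.
  apply: (@le_trans _ _ (d%:R * \sum_(1 <= k < p./2.+1) theta k * E k)).
    rewrite mulr_sumr; apply: ler_sum_nat => k /andP[k1 k2].
    by have /andP[] : 0 <= E k - kern d (step * k%:R) <= d%:R * (theta k * E k) by apply/kern_freq_diff/andP.
  by rewrite ler_wpM2l // sum_theta_kern.
have -> : n' * J / (pi * v) = 2 * (J / step).
  by rewrite /step; move: n' n0 (pi : R) pi0 J {j1 j2} => m m0 q q0 J; field; rewrite !gt_eqF.
have jl : S2 <= J / step by rewrite ler_pdivlMr // mulrC.
have ju : J / step <= 1 + S2 + Q / 4.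
  rewrite ler_pdivrMr //; apply: (le_trans j2).
  rewrite !mulrDl mul1r [S2 * _]mulrC lerD2l.
  have hs : 4 * v / n' <= step.
    rewrite /step ler_pM2r ?invr_gt0 // ler_pM2r //; have := @pi_ge2 R; lra.
  have hN : n' / 4 <= (p./2)%:R by rewrite ler_pdivrMr // -natrM ler_nat.
  have v4 : 0 < 4 * v / n' by rewrite divr_gt0 // mulr_gt0.
  rewrite -div1r ler_pdivrMr ?mulr_gt0 ?ltr0n //.
  have Q0 : 0 < Q / 4 by rewrite !divr_gt0 // exprn_gt0.
  have a1 : Q / 4 * (4 * v / n') <= Q / 4 * step by rewrite ler_pM2l.
  have n4 : 0 <= n' / 4 by rewrite divr_ge0 // ltW.
  have a2 : 4 * v / n' * (n' / 4) <= step * (p./2)%:R by rewrite ler_pM // ltW.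
  have e : Q / 4 * (4 * v / n') * ((4 * v / n') * (n' / 4)) = 1.
    by rewrite /Q; move: n' n0 => m m0; field; rewrite !gt_eqF.
  by rewrite -[leLHS]e ler_pM // mulr_ge0 // ltW.
have Q0 : 0 < Q by rewrite divr_gt0 // exprn_gt0.
move/andP: S12 => [h1 h2]; rewrite ler_norml; apply/andP; split; nra.
Qed.

Lemma sum_kern_freq_mul :
  \sum_(k < n) kern d (v * freq R p k) * freq R p k <= 18 * (n' / v ^+ 2) + 4.
Proof.
have fM k : (k <= p)%N -> 0 <= E k * freq R p k <= 2.
  move=> kp; have y0 : 0 <= freq R p k by apply: freq_ge0; lia.
  rewrite mulr_ge0 ?(ltW (kern_gt0 _ _)) //= -[2]mul1r ler_pM ?(ltW (kern_gt0 _ _)) ?kern_le1 //.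
  by rewrite /freq ler_piMr // sin_le1.
have fsym k : (0 < k <= p)%N -> E (p.+1 - k)%N * freq R p (p.+1 - k) = E k * freq R p k.
  by move=> kp; rewrite /E freq_reflect //; lia.
have /andP[_ h] := sum_reflect_le fM fsym; apply: (le_trans h).
have : \sum_(1 <= k < p./2.+1) E k * freq R p k <= \sum_(1 <= k < p./2.+1) theta k * E k.
  apply: ler_sum_nat => k /andP[k1 k2]; rewrite mulrC ler_wpM2r ?(ltW (kern_gt0 _ _)) //.
  by have [_ /andP[]] : _ /\ _ := freq_bounds (k := k) k2.
have := sum_theta_kern; lra.
Qed.

End Freq.
End RiemannSums.

(** * The penalized least squares smoother *)

Section Smoother.
Variable R : realType.

Lemma freq_half p k : 2 * sin (2 * pi * k%:R / p.+1%:R / 2) = freq R p k.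
Proof.
by rewrite /freq; congr (_ * sin _); field; rewrite addrC natr1 pnatr_eq0.
Qed.

Lemma resp_kern p d (v : R) k : resp p d (v ^+ (2 * d)) k ^+ 2 = kern d (v * freq R p k).
Proof. by rewrite /resp /kern [(v * _) ^+ _]exprMn exprVn. Qed.

Definition smoother p d (nu : R) : 'M[R]_p.+1 := invmx (gram_from (diff_mx R p ^+ d) nu d).

Lemma trace_smoother_sqr (d : nat) (rho : int -> R) (L g0 : R) :
  (0 < d)%N -> (forall j, rho (- j) = rho j) ->
  (forall N, \sum_(1 <= j < N) j%:R * `|rho j%:Z| <= L) ->
  lagsum rho N @[N --> \oo] --> g0 ->
  exists C : R, forall (p : nat) (v : R) (S : 'M[R]_p.+1), (2 <= p)%N -> 0 < v ->
    (forall i j, S i j = rho ((i : nat)%:Z - (j : nat)%:Z)) ->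
    let G := smoother p d (v ^+ (2 * d)) in
    `|\tr (G *m G *m S) - p.+1%:R *
       (g0 * Beta (2 * d)%:R^-1 (2 - (2 * d)%:R^-1) / ((2 * d)%:R * pi) / v)|
    <= C * (p.+1%:R / v ^+ 2 + 1).
Proof.
move=> d0 rhoN rhoL cv.
have L0 := L_ge0 rhoL.
pose B := `|rho 0| + 2 * L.
have B0 : 0 <= B by rewrite addr_ge0 ?mulr_ge0.
(* The summands come from the [d] row updates, from the periodogram
   ([2 L (18 Q + 4 + 1) <= 46 L (Q + 1)] with [Q = n / v ^+ 2]) and from the Riemann sum. *)
exists (3 * B *+ d + 46 * L + `|g0| * (18 * d%:R + 5)) => p v S p2 v0 hS /=.
set nu := v ^+ (2 * d); have nu0 : 0 <= nu by rewrite exprn_ge0 // ltW.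
set n' : R := p.+1%:R; have n0 : 0 < n' by rewrite ltr0n.
have h1 := gram_from_tr (diff_mx R p ^+ d) d B0 nu0 (toeplitz_form_bounded rhoN rhoL hS).
have h2 : `|\sum_(k < p.+1) kern d (v * freq R p k) * (n'^-1 * \sum_(i < p.+1) \sum_(j < p.+1)
   rho ((i : nat)%:Z - (j : nat)%:Z) * cos (2 * pi * (k : nat)%:R / n' * ((i : nat)%:Z - (j : nat)%:Z)%:~R))
   - \sum_(k < p.+1) kern d (v * freq R p k) * g0| <= 46 * L * (n' / v ^+ 2 + 1).
  rewrite -sumrB (le_trans (ler_norm_sum _ _ _)) //.
  apply: (@le_trans _ _ (\sum_(k < p.+1) 2 * L * (kern d (v * freq R p k) * freq R p k + n'^-1))).
    apply: ler_sum => k _; rewrite -mulrBr normrM ger0_norm ?(ltW (kern_gt0 _ _)) //.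
    have hp := periodogram_mean rhoN rhoL p.+1 (2 * pi * (k : nat)%:R / n') cv.
    rewrite freq_half [`|freq _ _ _|]ger0_norm ?freq_ge0 ?(ltnW (ltn_ord k)) // in hp.
    have y0 : 0 <= freq R p k by rewrite freq_ge0 // ltnW.
    set P := \sum_(i < _) _ in hp *.
    have -> : n'^-1 * P - g0 = n'^-1 * (P - n' * g0) by field; rewrite gt_eqF.
    rewrite normrM [`|n'^-1|]gtr0_norm ?invr_gt0 //.
    apply: (@le_trans _ _ (kern d (v * freq R p k) * (2 * L * (freq R p k + n'^-1)))).
      rewrite ler_wpM2l ?(ltW (kern_gt0 _ _)) //.
      rewrite ler_pdivrMl // (le_trans hp) // -/n'.
      by rewrite [leRHS]mulrCA [n' * (_ + _)]mulrDr mulfV ?gt_eqF.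
    rewrite mulrCA ler_wpM2l ?mulr_ge0 // mulrDr lerD2l ler_piMl ?invr_ge0 ?(ltW n0) //.
    exact: kern_le1.
  rewrite -mulr_sumr big_split /= sumr_const card_ord -[n'^-1 *+ _]mulr_natl mulfV ?gt_eqF //.
  have := sum_kern_freq_mul p d0 v0; rewrite -/n'.
  have Q0 : 0 <= n' / v ^+ 2 by rewrite divr_ge0 ?exprn_ge0 ?(ltW n0) ?(ltW v0).
  set Sm := \sum_(k < _) _; move: (n' / v ^+ 2) Q0 => Q Q0 hS'; nra.
have h3 : `|\sum_(k < p.+1) kern d (v * freq R p k) * g0 - n' *
       (g0 * Beta (2 * d)%:R^-1 (2 - (2 * d)%:R^-1) / ((2 * d)%:R * pi) / v)|
    <= `|g0| * (18 * d%:R + 5) * (n' / v ^+ 2 + 1).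
  have h := sum_kern_freq d0 v0 p2.
  rewrite -mulr_suml [_ * g0]mulrC.
  have -> : n' * (g0 * Beta (2 * d)%:R^-1 (2 - (2 * d)%:R^-1) / ((2 * d)%:R * pi) / v) =
    g0 * (n' * (Beta (2 * d)%:R^-1 (2 - (2 * d)%:R^-1) / (2 * d)%:R) / (pi * v)).
    by rewrite !invfM; ring.
  rewrite -mulrBr normrM -[leRHS]mulrA ler_wpM2l // (le_trans h) // -/n'.
  have Q0 : 0 <= n' / v ^+ 2 by rewrite divr_ge0 ?exprn_ge0 ?(ltW n0) ?(ltW v0).
  have d1 : 0 <= d%:R :> R by []; move: (n' / v ^+ 2) Q0 => Q Q0; nra.
have Q0 : 0 <= n' / v ^+ 2 by rewrite divr_ge0 ?exprn_ge0 ?(ltW n0) ?(ltW v0).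
have h4 := tr_circulant d nu0 hS rhoN.
have {}h4 : \tr (invmx (gram_from (diff_mx R p ^+ d) nu 0) *m invmx (gram_from (diff_mx R p ^+ d) nu 0) *m S)
  = \sum_(k < p.+1) kern d (v * freq R p k) * (n'^-1 * \sum_(i < p.+1) \sum_(j < p.+1)
   rho ((i : nat)%:Z - (j : nat)%:Z) * cos (2 * pi * (k : nat)%:R / n' * ((i : nat)%:Z - (j : nat)%:Z)%:~R)).
  by rewrite h4; apply: eq_bigr => k _; rewrite resp_kern.
rewrite /= h4 in h1.
have d1 : 0 <= 3 * B *+ d by rewrite mulrn_wge0 // mulr_ge0.
set X := n' * _ in h3 *; set M := \sum_(k < p.+1) _ * g0 in h2 h3.
set T0 := \sum_(k < p.+1) _ in h1 h2.
rewrite /smoother -/nu; set T := \tr _ in h1 *.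
move: (T) (T0) (M) (X) (n' / v ^+ 2) (3 * B *+ d) (46 * L) (`|g0| * _) h1 h2 h3 Q0 d1.
move=> {}T {}T0 {}M {}X Q a b c h1 h2 h3 Q0 a0.
have e : T - X = (T - T0) + (T0 - M) + (M - X) by ring.
rewrite e (le_trans (ler_normD _ _)) // (le_trans (lerD (ler_normD _ _) (lexx _))) //.
by rewrite !mulrDl; nra.
Qed.

Lemma entryS n (m : 'cV[R]_n) (i : 'I_n) : entry m i.+1 = m i 0.
Proof. by rewrite /entry (big_pred1 i) // => k; rewrite eqSS. Qed.

Lemma pls_criterionE p d (nu : R) (Y m : 'cV[R]_p.+1) :
  pls_criterion d nu Y m =
  dot Y Y - 2 * dot Y m + dot m (gram_from (diff_mx R p ^+ d) nu d *m m).
Proof.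
have -> : dot m (gram_from (diff_mx R p ^+ d) nu d *m m) = dot m m +
    nu * \sum_(d.+1 <= t < p.+2) iter d nabla (entry m) t ^+ 2.
  rewrite /gram_from mulmxDl mul1mx dotDr -scalemxAl dotZr; congr (_ + _ * _).
  rewrite mulmx_suml big_add1 /= big_geq_mkord.
  have -> : dot m (\sum_(i < p.+1 | (d <= i)%N) (row i (diff_mx R p ^+ d))^T *m row i (diff_mx R p ^+ d) *m m) =
     \sum_(i < p.+1 | (d <= i)%N) dot (row i (diff_mx R p ^+ d))^T m ^+ 2.
    elim/big_rec2: _ => [|i y1 y2 _ <-]; first by rewrite /dot big1 // => j _;
      rewrite mxE mulr0.
    by rewrite dotDr -{2}[row i _]trmxK outer_mul dotZr (dotC m) expr2.
  apply: eq_big => [//|i di].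
  rewrite iter_nabla_diff_mx //; congr (_ ^+ 2); rewrite mxE.
  by apply: eq_bigr => j _; rewrite !mxE.
rewrite /pls_criterion addrA; congr (_ + _).
rewrite big_add1 /= big_mkord /dot mulr_sumr -sumrB -big_split /=.
by apply: eq_bigr => i _; rewrite !entryS; ring.
Qed.

(** For [g = A^-1 Y], the criterion at [h] exceeds that at [g] by [(h - g).A (h - g) >= |h - g|^2],
    so comparing a minimizer with [g] alone forces equality. *)
Lemma pls_estimateE p d (nu : R) (Y h : 'cV[R]_p.+1) : 0 <= nu ->
  is_pls_estimate d nu Y h -> h = smoother p d nu *m Y.
Proof.
move=> nu0 /(_ (smoother p d nu *m Y)); rewrite !pls_criterionE.
have hA := gram_from_above (diff_mx R p ^+ d) d nu0.
rewrite /smoother; set A := gram_from _ _ _ in hA *; set g := _ *m Y => h1.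
have Ag : A *m g = Y by rewrite /g mulmxA mulmxV ?mul1mx // above_id_unit.
have gh : dot g (A *m h) = dot Y h by rewrite -[X in dot g (X *m h)]hA.1 -dot_mull Ag.
pose w := h + (-1) *: g.
have e : dot w (A *m w) = dot h (A *m h) - 2 * dot Y h + dot Y g.
  rewrite /w mulmxDr -scalemxAr Ag dotDr dotZr.
  rewrite [dot (h + _) (A *m h)]dotC [dot (h + _) Y]dotC !dotDr !dotZr.
  rewrite (dotC (A *m h) g) gh (dotC (A *m h) h); ring.
have := hA.2 w; rewrite e => h2; rewrite Ag (dotC g Y) in h1.
suff : h + (-1) *: g = 0 by rewrite scaleN1r => /eqP; rewrite subr_eq0 => /eqP.
apply: dot_eq0; apply: (le_trans h2); lra.
Qed.

End Smoother.

(** * Independence and conditional expectation *)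

Section Indep.
Context {d : measure_display} {T : measurableType d} {R : realType}.
Variable P : probability T R.
Local Open Scope ereal_scope.

(* Both sides are integrals of tail probabilities over r >= 0. *)
Lemma ge0_integral_indep (X : T -> R) (A : set T) :
  measurable_fun setT X -> (forall w, 0 <= X w)%R -> measurable A ->
  (forall r, (0 <= r)%R -> P (X @^-1` `]r, +oo[ `&` A) = P (X @^-1` `]r, +oo[) * P A) ->
  \int[P]_(w in A) (X w)%:E = P A * \int[P]_w (X w)%:E.
Proof.
move=> mX X0 mA XA.
have mY : measurable_fun setT (fun w => X w * \1_A w)%R.
  by apply: measurable_funM => //; exact: measurable_indic.
pose X' : {RV P >-> R} := mfun_Sub (mem_set mX).
pose Y' : {RV P >-> R} := mfun_Sub (mem_set mY).
have eX := ge0_expectation_ccdf (X := X') X0.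
have Y0 w : (0 <= Y' w)%R by rewrite /= mulr_ge0.
have eY := ge0_expectation_ccdf (X := Y') Y0.
rewrite !unlock /= in eX eY.
have mcc : measurable_fun (`[0%R, +oo[%classic : set R) (ccdf X') by apply: measurable_funTS; exact: ccdf_measurable.
rewrite eX -ge0_integralZl //.
transitivity (\int[P]_w (X w * \1_A w)%:E).
  by rewrite integral_mkcond; apply: eq_integral => w _; rewrite patchE indicE;
    case: ifP => _; rewrite ?mulr1 ?mulr0.
rewrite eY; apply: eq_integral => r; rewrite inE /= in_itv /= andbT => r0.
rewrite /ccdf /distribution /pushforward /= muleC -XA //; congr (P _).
apply/seteqP; split => w /=; rewrite !in_itv /= !andbT indicE.
  case: (boolP (w \in A)) => [wA|_]; first by rewrite mulr1 => h; split => //; exact: set_mem.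
  by rewrite mulr0 ltNge r0.
by move=> [h /mem_set ->]; rewrite mulr1.
Qed.

(** The positive and negative parts have tail events that are preimages of rays under [X].
    Restriction to [A] multiplies both integrals by [P A], and the mean zero makes them equal and
    finite. *)
Lemma integral_indep_eq0 (X : T -> R) (A : set T) :
  P.-integrable setT (EFin \o X) -> \int[P]_w (X w)%:E = 0 -> measurable A ->
  (forall B : set R, measurable B -> P (X @^-1` B `&` A) = P (X @^-1` B) * P A) ->
  \int[P]_(w in A) (X w)%:E = 0.
Proof.
move=> iX EX mA XA.
have mX : measurable_fun setT X by apply/measurable_EFinP; exact: measurable_int iX.
have mXp : measurable_fun setT (fun w => Num.max (X w) 0%R) by exact: measurable_maxr.
have mXn : measurable_fun setT (fun w => Num.max (- X w) 0%R)%R.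
  by apply: measurable_maxr => //; exact: measurable_funN.
have Xp : \int[P]_(w in A) (Num.max (X w) 0%R)%:E = P A * \int[P]_w (Num.max (X w) 0%R)%:E.
  apply: ge0_integral_indep => // [w|r r0]; first by rewrite le_max lexx orbT.
  rewrite (_ : _ @^-1` _ = X @^-1` `]r, +oo[); first exact: XA.
  by apply/seteqP; split => w /=; rewrite !in_itv /= !andbT lt_max (ltNge r 0%R) r0 orbF.
have Xn : \int[P]_(w in A) (Num.max (- X w) 0%R)%:E = P A * \int[P]_w (Num.max (- X w) 0%R)%:E.
  apply: ge0_integral_indep => // [w|r r0]; first by rewrite le_max lexx orbT.
  rewrite (_ : _ @^-1` _ = X @^-1` `]-oo, (- r)%R[); first exact: XA.
  by apply/seteqP; split => w /=; rewrite !in_itv /= ?andbT lt_max (ltNge r 0%R) r0 orbF ltrNr.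
have fp : (EFin \o X)^\+ = (fun w => (Num.max (X w) 0%R)%:E).
  by apply/funext => w; rewrite unlock /= EFin_max.
have fn : (EFin \o X)^\- = (fun w => (Num.max (- X w) 0%R)%:E).
  by apply/funext => w; rewrite unlock /= EFin_max.
have fin : \int[P]_w (Num.max (X w) 0%R)%:E \is a fin_num.
  by rewrite -fp; apply: integrable_fin_num => //; exact: integrable_funepos.
have finn : \int[P]_w (Num.max (- X w) 0%R)%:E \is a fin_num.
  by rewrite -fn; apply: integrable_fin_num => //; exact: integrable_funeneg.
have e : \int[P]_w (Num.max (X w) 0%R)%:E = \int[P]_w (Num.max (- X w) 0%R)%:E.
  move: EX; rewrite (integralE _ _ (EFin \o X)) fp fn => /eqP.
  by rewrite sube_eq ?add0e // => /eqP.
rewrite (integralE _ _ (EFin \o X)) fp fn Xp Xn e subee // fin_numM //.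
exact: fin_num_measure.
Qed.

Variable F : set (set T).
Hypothesis Fm : F `<=` measurable.
Hypothesis FI : forall A B, F A -> F B -> F (A `&` B).

(** The uniqueness argument for conditional expectations, localized: [f < g] on [A = {f < g}] cut by
    [K k], while the integrals over [A] agree. *)
Lemma negligible_lt_condexp (f g : T -> R) (K : nat -> set T) :
  measurable_fun setT f -> measurable_fun setT g ->
  F [set w | f w < g w]%R -> (forall k, F (K k)) -> \bigcup_k K k = setT ->
  (forall k A, F A -> A `<=` K k ->
    [/\ P.-integrable A (EFin \o f), P.-integrable A (EFin \o g) &
     \int[P]_(w in A) (f w)%:E = \int[P]_(w in A) (g w)%:E]) ->
  P.-negligible [set w | f w < g w]%R.
Proof.
move=> mf mg Flt FK Kcov h.
rewrite -[X in P.-negligible X]setIT -Kcov setI_bigcupr.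
apply: negligible_bigcup => k; set A := _ `&` _.
have FA : F A by exact: FI.
have mA := Fm FA.
have [fi gi fg] := h k A FA (@subIsetr _ _ _).
have z : \int[P]_(w in A) `|(g w - f w)%:E| = 0.
  transitivity (\int[P]_(w in A) ((g w)%:E - (f w)%:E)).
    apply: eq_integral => w; rewrite inE => -[/= lt _].
    by rewrite -EFinB ger0_norm // subr_ge0 ltW.
  by rewrite integralB_EFin // fg subee // integrable_fin_num.
have mgf : measurable_fun A (fun w => (g w - f w)%:E).
  by apply/measurable_EFinP; apply: measurable_funTS; exact: measurable_funB.
have [N [mN PN sub]] := (ae_eq_integral_abs P mA mgf).1 z.
exists N; split => // w Aw; apply: sub => /= /(_ Aw) /eqP.
by rewrite eqe subr_eq0 => /eqP e; case: Aw => /=; rewrite e ltxx.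
Qed.

End Indep.

Section CondExp.
Context {d : measure_display} {T : measurableType d} {R : realType}.
Variable P : probability T R.

Lemma sigma_gen_measurable (I : Type) (D : set I) (X : I -> T -> R) :
  (forall i, D i -> measurable_fun setT (X i)) -> sigma_gen D X `<=` measurable.
Proof.
move=> mX; apply: smallest_sub; first exact: sigma_algebra_measurable.
by move=> A [i Di [B mB <-]]; apply: mX.
Qed.

Lemma sigma_gen_preimage (I : Type) (D : set I) (X : I -> T -> R) i (B : set R) :
  D i -> measurable B -> sigma_gen D X (X i @^-1` B).
Proof.
move=> Di mB; apply: sub_sigma_algebra; exists i => //.
by exists B => //; rewrite setTI.
Qed.

Section Gen.
Variables (I : Type) (D : set I) (X : I -> T -> R).
Let S := \bigcup_(i in D) preimage_set_system setT (X i) measurable.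
(** [T] carrying the generated sigma-algebra: measurability with respect to the latter becomes
    [measurable_fun] on [Tg]. *)
Let Tg := g_sigma_algebraType S.
Hypothesis mX : forall i, D i -> measurable_fun setT (X i).

Lemma sigma_gen_measurable_fun i : D i -> measurable_fun (setT : set Tg) (X i : Tg -> R).
Proof. by move=> Di _ B mB; rewrite setTI; exact: sigma_gen_preimage. Qed.

Lemma sigma_gen_lt (f g : T -> R) :
  measurable_fun (setT : set Tg) (f : Tg -> R) ->
  measurable_fun (setT : set Tg) (g : Tg -> R) ->
  sigma_gen D X [set w | f w < g w].
Proof.
move=> mf mg; have := measurable_fun_ltr mf mg measurableT.
by move=> /(_ [set true] Logic.I); rewrite setTI.
Qed.

(* [U] need not be integrable; [K k] is a localizing sequence for [U + V], hence
   for [U]. *)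
Lemma condexp_add_orthogonal (U V Z : T -> R) :
  measurable_fun (setT : set Tg) (U : Tg -> R) ->
  P.-integrable setT (EFin \o V) ->
  (forall A, sigma_gen D X A -> (\int[P]_(w in A) (V w)%:E = 0)%E) ->
  is_condexp P (sigma_gen D X) (fun w => U w + V w) Z ->
  P.-negligible [set w | Z w != U w].
Proof.
move=> mU iV V0 [[K [GK Kcov Kint]] mZ Zint].
have sub : sigma_gen D X `<=` measurable := sigma_gen_measurable mX.
have subI A B : sigma_gen D X A -> sigma_gen D X B -> sigma_gen D X (A `&` B).
  exact: (@measurableI _ Tg).
have mZg : measurable_fun (setT : set Tg) (Z : Tg -> R).
  by move=> _ B mB; rewrite setTI; exact: mZ.
have toT (f : T -> R) : measurable_fun (setT : set Tg) (f : Tg -> R) -> measurable_fun (setT : set T) f.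
  move=> mf _ B mB; apply: sub; exact: mf.
have key k A : sigma_gen D X A -> A `<=` K k ->
    [/\ P.-integrable A (EFin \o U), P.-integrable A (EFin \o Z) &
     (\int[P]_(w in A) (U w)%:E = \int[P]_(w in A) (Z w)%:E)%E].
  move=> GA AK; have mA := sub _ GA.
  have iX : P.-integrable A (EFin \o (fun w => U w + V w)).
    by apply: integrableS (Kint k) => //; apply: sub; exact: GK.
  have iVA : P.-integrable A (EFin \o V) by apply: integrableS iV.
  have iU : P.-integrable A (EFin \o U).
    have := integrableB mA iX iVA; apply: eq_integrable => // w _ /=.
    by rewrite -EFinB addrK.
  have [iZ eZ] := Zint A GA iX.
  split=> //; rewrite eZ.
  under [RHS]eq_integral do rewrite EFinD.
  by rewrite integralD_EFin // V0 // adde0.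
rewrite (_ : [set w | _] = [set w | U w < Z w] `|` [set w | Z w < U w]).
  apply: negligibleU.
    by apply: (negligible_lt_condexp sub subI (K := K)) => //;
      [exact: toT|exact: toT|exact: sigma_gen_lt].
  apply: (negligible_lt_condexp sub subI (K := K)) => //;
    [exact: toT|exact: toT|exact: sigma_gen_lt|].
  by move=> k A GA AK; have [] := key k A GA AK.
apply/seteqP; split => w /=.
  by rewrite neq_lt => /orP[h|h]; [right|left].
by rewrite neq_lt => -[->|->]; rewrite ?orbT.
Qed.

End Gen.

Lemma indep_sigma_integral_eq0 (I : Type) (D : set I) (X : I -> T -> R)
    (J : Type) (Y : J -> T -> R) (t : J) (A : set T) :
  (forall i, D i -> measurable_fun setT (X i)) ->
  P.-integrable setT (EFin \o Y t) -> (\int[P]_w (Y t w)%:E = 0)%E ->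
  indep_sigma P (sigma_gen setT Y) (sigma_gen D X) -> sigma_gen D X A ->
  (\int[P]_(w in A) (Y t w)%:E = 0)%E.
Proof.
move=> mX iY EY ind GA; apply: integral_indep_eq0 => //.
  exact: (sigma_gen_measurable mX).
by move=> B mB; apply: ind => //; exact: sigma_gen_preimage.
Qed.

End CondExp.

(** * The risk as a trace *)

Section Risk.
Context {dT : measure_display} {T : measurableType dT} {R : realType}.
Variable P : probability T R.

Lemma expectation_lincomb (I : finType) (c : I -> R) (F : I -> T -> R) :
  (forall i, F i \in Lfun P 1%E) ->
  ('E_P[fun w => (\sum_i c i * F i w)%R] = \sum_i (c i)%:E * 'E_P[F i])%E.
Proof.
move=> F1; have iF i : P.-integrable setT (EFin \o F i) by exact/Lfun1_integrable.
rewrite unlock; under eq_integral do rewrite -sumEFin.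
rewrite integral_sum //; last first.
  move=> i; under eq_fun do rewrite EFinM.
  by apply: integrableZl => //; exact: iF.
apply: eq_bigr => i _; under eq_integral do rewrite EFinM.
by rewrite integralZl //; exact: iF.
Qed.

Variable eps : int -> {RV P >-> R}.
Hypotheses (eps_stat : stationary P eps) (eps_mean : forall t, ('E_P[eps t] = 0)%E).

Lemma autocov_sym j : autocov P eps (- j) = autocov P eps j.
Proof.
have [_ _ sh] := eps_stat.
by rewrite /autocov -(sh 0 (- j) j) addNr add0r covarianceC.
Qed.

Lemma eps_mul_Lfun s t : (fun w => eps s w * eps t w) \in Lfun P 1%E.
Proof. by have [L2 _ _] := eps_stat; exact: (Lfun2_mul_Lfun1 (L2 s) (L2 t)). Qed.

Lemma eps_mul_expectation s t :
  ('E_P[fun w => (eps s w * eps t w)%R] = (autocov P eps (t - s))%:E)%E.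
Proof.
have [_ _ sh] := eps_stat.
have e : covariance P (eps s) (eps t) = ('E_P[fun w => (eps s w * eps t w)%R])%E.
  rewrite covariance.unlock !eps_mean /=; congr expectation.
  by apply/funext => w; rewrite !fctE /= !subr0.
have := sh 0 (t - s) s; rewrite add0r subrK e /autocov => <-.
by rewrite fineK // expectation_fin_num // eps_mul_Lfun.
Qed.

Lemma eps_integrable t : P.-integrable setT (EFin \o eps t).
Proof.
have [L2 _ _] := eps_stat; apply/Lfun1_integrable.
by apply: Lfun_subset12 => //; exact: fin_num_measure.
Qed.

Variables (p d : nat) (nu : R).
Hypothesis nu_ge0 : 0 <= nu.
Variables (mu muhat mubar : T -> 'cV[R]_p.+1).
Hypothesis mu_meas : forall i, measurable_fun setT (fun w => mu w i 0).
Hypothesis indep : indep_sigma P (sigma_gen setT eps)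
  (sigma_gen setT (fun (i : 'I_p.+1) w => mu w i 0)).
Let noise (w : T) : 'cV[R]_p.+1 := \col_i eps i.+1%:Z w.
Hypothesis muhatP : forall w, is_pls_estimate d nu (mu w + noise w) (muhat w).
Hypothesis mubarP : forall i, is_condexp P
  (sigma_gen setT (fun (k : 'I_p.+1) w => mu w k 0))
  (fun w => muhat w i 0) (fun w => mubar w i 0).
Let G := smoother p d nu.

Lemma smoother_sym : G^T = G.
Proof. by rewrite /G /smoother trmx_inv (gram_from_above _ _ nu_ge0).1. Qed.

(** The estimate is [G mu + G noise]. The first part is measurable for the trend; the second is
    integrable, and by independence integrates to 0 over every event of the trend. *)
Lemma mubar_ae i : P.-negligible [set w | mubar w i 0 != (G *m mu w) i 0].
Proof.
apply: (@condexp_add_orthogonal _ _ _ P 'I_p.+1 setT (fun k w => mu w k 0) _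
  (fun w => (G *m mu w) i 0) (fun w => (G *m noise w) i 0)).
- by move=> k _; exact: mu_meas.
- have -> : (fun w => (G *m mu w) i 0) = (fun w => \sum_k G i k * mu w k 0).
    by apply/funext => w; rewrite mxE.
  apply: measurable_sum => k; apply: measurable_funM; first exact: measurable_cst.
  by apply: (@sigma_gen_measurable_fun _ _ _ 'I_p.+1 setT (fun k w => mu w k 0)).
- rewrite (_ : EFin \o _ = (fun w => \sum_(k < p.+1) (G i k)%:E * (eps k.+1%:Z w)%:E)%E).
    by apply: integrable_sum => // k _; apply: integrableZl => //; exact: eps_integrable.
  apply/funext => w /=; rewrite mxE -sumEFin; apply: eq_bigr => k _.
  by rewrite EFinM [noise w _ _]mxE.
- move=> A GA; have mA := sigma_gen_measurable (fun k _ => mu_meas k) GA.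
  transitivity (\int[P]_(w in A) (\sum_(k < p.+1) (G i k)%:E * (eps k.+1%:Z w)%:E))%E.
    apply: eq_integral => w _; rewrite mxE -sumEFin; apply: eq_bigr => k _.
    by rewrite EFinM [noise w _ _]mxE.
  have iA t : P.-integrable A (EFin \o eps t) by apply: integrableS (eps_integrable t).
  rewrite integral_sum //; last by move=> k; apply: integrableZl => //; exact: iA.
  rewrite big1 // => k _; rewrite integralZl //; last exact: iA.
  rewrite (indep_sigma_integral_eq0 (fun k _ => mu_meas k) _ _ indep GA) ?mule0 //.
    exact: eps_integrable.
  by rewrite -expectation_def eps_mean.
- have := mubarP i; congr (is_condexp _ _ _ _); apply/funext => w.
  by rewrite (pls_estimateE nu_ge0 (muhatP w)) mulmxDr mxE.
Qed.

Lemma enorm_sqr n (v : 'cV[R]_n) : enorm v ^+ 2 = dot v v.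
Proof.
rewrite /enorm sqr_sqrtr; last by apply: sumr_ge0 => i _; exact: sqr_ge0.
by apply: eq_bigr => i _; rewrite expr2.
Qed.

Lemma risk_trace (S : 'M[R]_p.+1) :
  (forall i j, S i j = autocov P eps ((i : nat)%:Z - (j : nat)%:Z)) ->
  ('E_P[fun w => (enorm (muhat w - mubar w) ^+ 2 / p.+1%:R)%R] =
   (\tr (G *m G *m S) / p.+1%:R)%:E)%E.
Proof.
move=> hS.
pose c (q : 'I_p.+1 * 'I_p.+1) := (G *m G) q.1 q.2 / p.+1%:R.
pose F (q : 'I_p.+1 * 'I_p.+1) w := eps q.1.+1%:Z w * eps q.2.+1%:Z w.
have noiseE w : dot (G *m noise w) (G *m noise w) / p.+1%:R = \sum_q c q * F q w.
  rewrite dot_mull smoother_sym mulmxA /dot mulr_suml.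
  rewrite -(pair_bigA _ (fun j k => c (j, k) * F (j, k) w)) /=.
  apply: eq_bigr => j _; rewrite [noise w j 0]mxE mxE mulr_sumr mulr_suml.
  by apply: eq_bigr => k _; rewrite /c /F [noise w k 0]mxE /=; ring.
transitivity ('E_P[fun w => (\sum_q c q * F q w)%R])%E.
  have mhat i : measurable_fun setT (fun w => muhat w i 0).
    have -> : (fun w => muhat w i 0) = (fun w => \sum_k G i k * (mu w k 0 + eps k.+1%:Z w)).
      apply/funext => w; rewrite (pls_estimateE nu_ge0 (muhatP w)) mxE.
      by apply: eq_bigr => k _; rewrite !mxE.
    apply: measurable_sum => k; apply: measurable_funM; first exact: measurable_cst.
    by apply: measurable_funD => //; exact: mu_meas.
  have mbar i : measurable_fun setT (fun w => mubar w i 0).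
    move=> _ B mB; rewrite setTI.
    apply: (sigma_gen_measurable (fun k _ => mu_meas k)).
    by have [_ + _] := mubarP i; exact.
  have mc (k : nat) : measurable_fun setT (fun w => eps k.+1%:Z w) by [].
  rewrite unlock; apply: ae_eq_integral => //.
  - apply/measurable_EFinP; apply: measurable_funM; last exact: measurable_cst.
    under eq_fun do rewrite enorm_sqr /dot.
    apply: measurable_sum => i; under eq_fun do rewrite !mxE.
    by apply: measurable_funM; apply: measurable_funB.
  - apply/measurable_EFinP; apply: measurable_sum => q.
    apply: measurable_funM; first exact: measurable_cst.
    by apply: measurable_funM; exact: mc.
  (* The union runs over all of [nat] to use countable subadditivity; [inord] turns each [k] into a
     valid coordinate and reaches them all. *)
  have : P.-negligible (\bigcup_k [set w | mubar w (inord k) 0 != (G *m mu w) (inord k) 0]).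
    by apply: negligible_bigcup => k; exact: mubar_ae.
  apply: negligibleS => w /= h; apply: contrapT => nw; apply: h => _.
  congr EFin; rewrite -noiseE enorm_sqr.
  have -> : muhat w - mubar w = G *m noise w.
    rewrite (pls_estimateE nu_ge0 (muhatP w)) mulmxDr.
    suff -> : mubar w = G *m mu w by rewrite addrC addKr.
    apply/matrixP => i j; rewrite (ord1 j); apply/eqP/negPn/negP => ne; apply: nw.
    by exists i => //=; rewrite inord_val.
  by [].
rewrite expectation_lincomb; last by move=> q; exact: eps_mul_Lfun.
under eq_bigr => q _ do rewrite eps_mul_expectation -EFinM.
rewrite sumEFin; congr EFin.
rewrite -(pair_bigA _ (fun j k => c (j, k) * autocov P eps (k.+1%:Z - j.+1%:Z))) /=.
rewrite /mxtrace mulr_suml; apply: eq_bigr => j _; rewrite mxE mulr_suml.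
apply: eq_bigr => k _; rewrite hS /c /= -!natz -[j.+1%:R]natr1 -[k.+1%:R]natr1.
by rewrite opprD addrACA subrr addr0 mulrAC.
Qed.

End Risk.

(** * From the trace bound to the relative expansion of the risk *)

Theorem theorem1 (R : realType) (d : nat) (hd : (1 <= d)%N)
  (tau : R) (htau : 0 < tau)
  (dT : nat -> measure_display) (T : forall n, measurableType (dT n))
  (P : forall n, probability (T n) R)
  (eps : forall n, int -> {RV (P n) >-> R})
  (gam : forall n, nat -> {RV (P n) >-> R})
  (mu : forall n, T n -> 'cV[R]_n)
  (mu_meas : forall n (i : 'I_n), measurable_fun setT (fun w => mu n w i 0))
  (eps_law : forall n m, same_law (P n) (P m) (eps n) (eps m))
  (eps_stat : forall n, stationary (P n) (eps n))
  (eps_mean : forall n t, ('E_(P n)[eps n t] = 0)%E)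
  (trend : forall n t w, (d < t <= n)%N ->
     iter d nabla (entry (mu n w)) t = gam n t w)
  (gam_iid : forall n, iid (P n) [set t | (d < t <= n)%N] (gam n))
  (gam_mean : forall n t, (d < t <= n)%N -> ('E_(P n)[gam n t] = 0)%E)
  (gam_var : forall n t, (d < t <= n)%N ->
     variance (P n) (gam n t) = (tau ^+ 2 / n%:R ^+ (2 * d - 1))%:E)
  (eps_gam_indep : forall n, indep_sigma (P n)
     (sigma_gen setT (eps n))
     (sigma_gen [set t | (d < t <= n)%N] (gam n)))
  (eps_mu_indep : forall n, indep_sigma (P n)
     (sigma_gen setT (eps n))
     (sigma_gen setT (fun (i : 'I_n) w => mu n w i 0)))
  (rho : int -> R) (hrho : forall n j, autocov (P n) (eps n) j = rho j)
  (rho_sum : (\sum_(1 <= j <oo) (j%:R * `|rho j%:Z|)%:E < +oo)%E)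
  (g0_gt0 : 0 < spectral rho 0)
  (nu : nat -> R) (nu_gt0 : forall n, 0 < nu n)
  (nu_oo : nu n @[n --> \oo] --> +oo)
  (nu_n0 : nu n / n%:R ^+ (2 * d) @[n --> \oo] --> 0)
  (muhat : forall n, T n -> 'cV[R]_n)
  (muhatP : forall n w,
     is_pls_estimate d (nu n) (mu n w + \col_(i < n) eps n i.+1%:Z w) (muhat n w))
  (mubar : forall n, T n -> 'cV[R]_n)
  (mubarP : forall n (i : 'I_n),
     is_condexp (P n) (sigma_gen setT (fun (k : 'I_n) w => mu n w k 0))
       (fun w => muhat n w i 0) (fun w => mubar n w i 0)) :
  let b : R := (2 * d)%:R^-1 in
  let c1 : R := complex.Re (spectral rho 0) * Beta b (2 - b) / ((2 * d)%:R * pi) in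
  exists r1 r2 : nat -> R,
    [/\ r1 =O_\oo (fun n => nu n `^ (- b)),
        r2 =O_\oo (fun n => nu n `^ b / n%:R) &
        \forall n \near \oo,
          ('E_(P n)[fun w => (enorm (muhat n w - mubar n w) ^+ 2 / n%:R)%R]
           = (c1 * nu n `^ (- b) * (1 + r1 n + r2 n))%:E)%E].
Proof.
move=> b c1.
have rhoN j : rho (- j) = rho j.
  by rewrite -(hrho 0%N) -(hrho 0%N) autocov_sym.
pose L := fine (\sum_(1 <= j <oo) (j%:R * `|rho j%:Z|)%:E)%E.
have rhoL N : \sum_(1 <= j < N) j%:R * `|rho j%:Z| <= L.
  have t0 j : (0 <= (j%:R * `|rho j%:Z|)%:E)%E by rewrite lee_fin mulr_ge0.
  rewrite -lee_fin /L fineK; last first.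
    by rewrite ge0_fin_numE //; apply: nneseries_ge0.
  rewrite -sumEFin; apply: nneseries_lim_ge => j _ _; exact: t0.
pose g0 := complex.Re (spectral rho 0).
have g0_pos : 0 < g0 by move: g0_gt0; rewrite ltcE /= => /andP[].
have cv : lagsum rho N @[N --> \oo] --> g0.
  apply: sum_symmetric_cvg => //; last exact: lagsum_cvg rhoL.
  rewrite /g0 /=; congr sumZ; apply/funext => j.
  by rewrite mulr0 cos0 mulr1.
have [C hC] := trace_smoother_sqr hd rhoN rhoL cv.
have K_gt0 : 0 < (2 * d)%:R :> R by rewrite ltr0n; lia.
pose v n := nu n `^ b.
have v_gt0 n : 0 < v n by exact: powR_gt0.
have vK n : v n ^+ (2 * d) = nu n.
  rewrite -powR_mulrn ?(ltW (v_gt0 n)) // -powRrM mulVf ?gt_eqF // powRr1 //.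
  exact: ltW.
have vN n : nu n `^ (- b) = (v n)^-1 by rewrite powRN.
have J_gt0 : 0 < Beta b (2 - b).
  (* A one-term lower Riemann sum, with step 1, already shows that the Beta value is positive. *)
  have /andP[h _] := Beta_riemann hd (@ltr01 R) (ltn0Sn 0).
  have : 0 < Beta b (2 - b) / (2 * d)%:R.
    by apply: lt_le_trans h; rewrite big_nat1 mul1r kern_gt0.
  by rewrite pmulr_lgt0 // invr_gt0.
have c1_gt0 : 0 < c1 by rewrite divr_gt0 ?mulr_gt0 // pi_gt0.
pose risk n : R := fine ('E_(P n)[fun w => (enorm (muhat n w - mubar n w) ^+ 2 / n%:R)%R]).
have main n : (2 < n)%N ->
    ('E_(P n)[fun w => (enorm (muhat n w - mubar n w) ^+ 2 / n%:R)%R] = (risk n)%:E)%E /\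
    `|risk n - c1 / v n| <= C * ((v n) ^- 2 + n%:R^-1).
  rewrite /risk; case: n => // p p2.
  pose S : 'M[R]_p.+1 := \matrix_(i, j) rho ((i : nat)%:Z - (j : nat)%:Z).
  have hS i j : S i j = rho ((i : nat)%:Z - (j : nat)%:Z) by rewrite mxE.
  have hS' i j : S i j = autocov (P p.+1) (eps p.+1) ((i : nat)%:Z - (j : nat)%:Z).
    by rewrite hS hrho.
  rewrite (risk_trace (eps_stat p.+1) (eps_mean p.+1) (ltW (nu_gt0 p.+1))
    (mu_meas p.+1) (eps_mu_indep p.+1) (muhatP p.+1) (mubarP p.+1) hS') /=; split=> //.
  have := hC p (v p.+1) S p2 (v_gt0 p.+1) hS; rewrite vK /= -/b.
  have n0 : 0 < p.+1%:R :> R by rewrite ltr0n.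
  set t := \tr _; rewrite -/g0 -/c1 => h.
  rewrite -(ler_pM2l n0) -[X in X * `|_|]gtr0_norm //
    -normrM mulrBr mulrCA mulfV ?gt_eqF // mulr1.
  apply: (le_trans h); rewrite le_eqVlt; apply/orP; left; apply/eqP.
  by field; rewrite addrC natr1 !gt_eqF.
(* The relative error [e] is split between the two remainders in proportion
   to their bounds [x] and [y]. *)
pose x n := (v n)^-1; pose y n := v n / n%:R.
pose e n := risk n / (c1 / v n) - 1.
have x_gt0 n : 0 < x n by rewrite invr_gt0.
have y_ge0 n : 0 <= y n by rewrite divr_ge0 // ltW.
have xy_gt0 n : 0 < x n + y n by rewrite ltr_pwDl.
(* Multiplying [v^-2 + 1/n] by [v / c1] gives [(x + y) / c1]. The absolute value avoids tracking the
   sign of [C], and the added 1 makes the constant positive, as the big-O criterion demands. *)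
have e_le n : (2 < n)%N -> `|e n| <= (`|C| / c1 + 1) * (x n + y n).
  move=> n2; have [_ h] := main n n2.
  have nn : 0 < n%:R :> R by rewrite ltr0n (leq_ltn_trans _ n2).
  have -> : e n = (risk n - c1 / v n) * (v n / c1).
    by rewrite /e; field; rewrite !gt_eqF.
  have vc : 0 < v n / c1 by rewrite divr_gt0.
  rewrite normrM [X in _ * X]gtr0_norm //.
  apply: (@le_trans _ _ (`|C| / c1 * (x n + y n))).
    have -> : `|C| / c1 * (x n + y n) = `|C| * ((v n) ^- 2 + n%:R^-1) * (v n / c1).
      by rewrite /x /y; field; rewrite !gt_eqF.
    rewrite ler_wpM2r ?(ltW vc) // (le_trans h) // ler_wpM2r ?ler_norm //.
    by rewrite addr_ge0 ?invr_ge0 ?exprn_ge0 ?(ltW (v_gt0 n)) ?(ltW nn).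
  by rewrite ler_wpM2r ?(ltW (xy_gt0 n)) // lerDl.
have bound_gt0 : 0 < `|C| / c1 + 1 by rewrite ltr_wpDl // divr_ge0 // ltW.
have split_le n (z : R) : (2 < n)%N -> 0 <= z -> `|e n * (z / (x n + y n))| <= (`|C| / c1 + 1) * z.
  move=> n2 z0; rewrite normrM (ger0_norm (divr_ge0 z0 (ltW (xy_gt0 n)))) mulrA ler_pdivrMr //.
  by rewrite mulrAC ler_wpM2r // e_le.
exists (fun n => e n * (x n / (x n + y n))), (fun n => e n * (y n / (x n + y n))); split.
- apply/eqO_exP; exists (`|C| / c1 + 1) => //; near=> n.
  rewrite vN (gtr0_norm (x_gt0 n)) split_le ?(ltW (x_gt0 n)) //.
  by near: n; exact: nbhs_infty_gt.
- apply/eqO_exP; exists (`|C| / c1 + 1) => //; near=> n.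
  rewrite -/(v n) -/(y n) (ger0_norm (y_ge0 n)) split_le //.
  by near: n; exact: nbhs_infty_gt.
near=> n.
have n2 : (2 < n)%N by near: n; exact: nbhs_infty_gt.
rewrite (main n n2).1 vN; congr EFin.
rewrite -addrA -mulrDr -mulrDl mulfV ?gt_eqF // mulr1 /e addrC subrK.
by field; rewrite !gt_eqF.
Unshelve. all: by end_near. Qed.
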